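(* Consider Problem (P) under Assumption (A) over a graph satisfying Assumption (B), and run SONATA with weight matrix satisfying Assumption (W) and surrogates satisfying Assumption (C), where $\tilde\mu_{\min}\ge D^\ell_{\min}$. Then there exists a step-size threshold $\bar\alpha\in(0,1]$ such that for every step-size $\alpha\in(0,\bar\alpha)$ and every agent $i\in\{1,\dots,m\}$, the sequence $\{U(x_i^\nu)\}_{\nu\ge0}$ converges to $U^\star$ at an R-linear rate, i.e. $|U(x_i^\nu)-U^\star|=O(z^\nu)$ for some $z\in(0,1)$.
   Context: Problem (P): minimize $U(x):=F(x)+G(x)$ subject to $x\in\mathcal K$, where $F(x)=\frac1m\sum_{i=1}^m f_i(x)$. Assumption (A): $\mathcal K\subseteq\mathbb R^d$ is nonempty, closed, convex; each $f_i:\mathcal O\to\mathbb R$ is twice differentiable and convex on an open set $\mathcal O\supseteq\mathcal K$; $\mu I\preceq\nabla^2F(x)\preceq LI$ for all $x\in\mathcal K$, with $\mu>0$, $L<\infty$; $G:\mathcal K\to\mathbb R$ is convex (possibly nonsmooth). Let $x^\star$ be the unique minimizer and $U^\star=U(x^\star)$. Assumption (B): agents communicate over a connected undirected graph on nodes $\{1,\dots,m\}$ with edge set $\mathcal E$. Assumption (W): $W=(w_{ij})$ satisfies $w_{ii}>0$, $w_{ij}>0$ if $(i,j)\in\mathcal E$ and $w_{ij}=0$ otherwise ($i\neq j$), and $W$ is doubly stochastic. Assumption (C): each surrogate $\tilde f_i:\mathcal O\times\mathcal O\to\mathbb R$ is $C^2$ and, for all $x\in\mathcal K$: $\nabla\tilde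 f_i(x;x)=\nabla f_i(x)$ (gradient in the first argument); $\nabla\tilde f_i(\cdot;x)$ is $\tilde L_i$-Lipschitz on $\mathcal K$; $\tilde f_i(\cdot;x)$ is $\tilde\mu_i$-strongly convex on $\mathcal K$ ($\tilde\mu_i>0$). Constants $D_i^\ell\le D_i^u$ are such that $D_i^\ell I\preceq\nabla^2\tilde f_i(x;y)-\nabla^2F(x)\preceq D_i^uI$ for all $x,y\in\mathcal K$ (Hessian of $\tilde f_i$ in its first argument); $\tilde\mu_{\min}=\min_i\tilde\mu_i$, $D^\ell_{\min}=\min_iD_i^\ell$. SONATA (step-size $\alpha\in(0,1]$): initialize $x_i^0\in\mathcal K$, $y_i^0=\nabla f_i(x_i^0)$; for $\nu=0,1,\dots$ each agent computes $\hat x_i^\nu=\arg\min_{x_i\in\mathcal K}\tilde f_i(x_i;x_i^\nu)+(y_i^\nu-\nabla f_i(x_i^\nu))^\top(x_i-x_i^\nu)+G(x_i)$, $x_i^{\nu+1/2}=x_i^\nu+\alpha(\hat x_i^\nu-x_i^\nu)$, $x_i^{\nu+1}=\sum_jw_{ij}x_j^{\nu+1/2}$, $y_i^{\nu+1}=\sum_jw_{ij}\big(y_j^\nu+\nabla f_j(x_j^{\nu+1})-\nabla f_j(x_j^\nu)\big)$. *)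

(* Defs.v *)
From HB Require Import structures.
From mathcomp Require Import all_boot all_order all_algebra.
From mathcomp Require Import all_classical all_reals all_analysis.
Set Implicit Arguments. Unset Strict Implicit. Unset Printing Implicit Defensive.
Import Order.TTheory GRing.Theory Num.Theory.
Import numFieldNormedType.Exports.
Local Open Scope classical_set_scope.
Local Open Scope ring_scope.

Section Defs.
Variable R : realType.

Definition dotp (d : nat) (u v : 'rV[R]_d) : R := \sum_(j < d) u 0 j * v 0 j.
Definition enorm (d : nat) (v : 'rV[R]_d) : R := Num.sqrt (dotp v v).
Definition qform (d : nat) (H : 'M[R]_d) (v : 'rV[R]_d) : R := (v *m H *m v^T) 0 0.

Definition ebasis (d : nat) (j : 'I_d) : 'rV[R]_d := delta_mx 0 j.

Definition grad (d : nat) (g : 'rV[R]_d -> R) (x : 'rV[R]_d) : 'rV[R]_d :=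
  \row_(j < d) derive g x (ebasis j).
Definition hess (d : nat) (g : 'rV[R]_d -> R) (x : 'rV[R]_d) : 'M[R]_d :=
  \matrix_(i < d, j < d) derive (fun z => derive g z (ebasis j)) x (ebasis i).

Definition twice_diff_on_set (d : nat) (g : 'rV[R]_d -> R) (O : set 'rV[R]_d) :=
  forall x, O x -> differentiable g x /\
    forall j : 'I_d, differentiable (fun z => derive g z (ebasis j)) x.

Definition C2_on (d : nat) (g : 'rV[R]_d -> R) (O : set 'rV[R]_d) :=
  twice_diff_on_set g O /\
  forall i j : 'I_d, {within O, continuous (fun x => hess g x i j)}.

Definition cvx_set (d : nat) (S : set 'rV[R]_d) :=
  forall x y t, S x -> S y -> 0 <= t <= 1 -> S (t *: x + (1 - t) *: y).

Definition cvx_fun_on (d : nat) (g : 'rV[R]_d -> R) (S : set 'rV[R]_d) :=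
  forall x y t, S x -> S y -> 0 <= t <= 1 -> S (t *: x + (1 - t) *: y) ->
    g (t *: x + (1 - t) *: y) <= t * g x + (1 - t) * g y.

Definition strongly_cvx_on (d : nat) (mu : R) (g : 'rV[R]_d -> R)
    (S : set 'rV[R]_d) :=
  forall x y t, S x -> S y -> 0 <= t <= 1 ->
    g (t *: x + (1 - t) *: y) <=
      t * g x + (1 - t) * g y - mu / 2 * t * (1 - t) * (enorm (x - y)) ^+ 2.

Definition lip_map_on (d : nat) (Lip : R) (h : 'rV[R]_d -> 'rV[R]_d)
    (S : set 'rV[R]_d) :=
  forall x y, S x -> S y -> enorm (h x - h y) <= Lip * enorm (x - y).

Definition min_over (m : nat) : ('I_m -> R) -> R :=
  match m return ('I_m -> R) -> R with
  | 0 => fun _ => 0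
  | n.+1 => fun a => \big[Num.min/a ord0]_(i < n.+1) a i
  end.

Definition weight_matrix (m : nat) (E : rel 'I_m) (W : 'M[R]_m) :=
  (forall i, 0 < W i i) /\
  (forall i j, i != j -> (E i j -> 0 < W i j) /\ (~~ E i j -> W i j = 0)) /\
  (forall i j, 0 <= W i j) /\
  (forall i, \sum_(j < m) W i j = 1) /\
  (forall j, \sum_(i < m) W i j = 1).

End Defs.

Definition connected_undirected (m : nat) (E : rel 'I_m) :=
  irreflexive E /\ symmetric E /\ forall i j : 'I_m, connect E i j.

Definition C2_on_pair (R : realType) (d : nat)
    (ft : 'rV[R]_d -> 'rV[R]_d -> R) (O : set 'rV[R]_d) :=
  C2_on (fun z : 'rV[R]_(d + d) => ft (lsubmx z) (rsubmx z))
        [set z | O (lsubmx z) /\ O (rsubmx z)].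

(* Main.v *)
(* A Lyapunov argument. Write [p] for the sum over agents of [U(x_i) - U*], [X]
   and [Y] for the squared deviations of the [x_i] and the [y_i] from their
   means, and [D] for the sum of the [|xhat_i - x_i|^2]. Mixing contracts [X]
   and [Y] by a factor [rho < 1], up to perturbations of order [alpha^2 D] and,
   for [Y], [X]; and by Jensen a step decreases [p] by
   [alpha (c p + c' D) - O(alpha (X + Y))], because optimality of [xhat_i]
   makes the step a descent direction and bounds [U(xhat_i) - U*] by
   [|xhat_i - x_i|^2] plus the squared tracking error, itself [O(X + Y)]. Hence
   [p + b X + Y] contracts by [1 - c alpha] for suitable [b] and small [alpha].
   The individual gradients are Lipschitz on [K] although only the Hessian of
   the average is bounded, because every [f_i] is convex. *)

Require Import Defs.
From HB Require Import structures.
From mathcomp Require Import all_boot all_order all_algebra.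
From mathcomp Require Import all_classical all_reals all_analysis.
From mathcomp Require Import ring lra.
Import Order.TTheory GRing.Theory Num.Theory.
Import numFieldNormedType.Exports.
Local Open Scope classical_set_scope.
Local Open Scope ring_scope.

Set Implicit Arguments.
Unset Strict Implicit.

(** * Euclidean inner product and squared norm *)

Section InnerProduct.
Variables (R : realType) (d : nat).
Implicit Types u v w : 'rV[R]_d.

Lemma dotpC u v : dotp u v = dotp v u.
Proof. by apply: eq_bigr => j _; rewrite mulrC. Qed.

Lemma dotpDl u v w : dotp (u + v) w = dotp u w + dotp v w.
Proof. by rewrite -big_split /=; apply: eq_bigr => j _; rewrite mxE mulrDl. Qed.

Lemma dotpZl (a : R) u v : dotp (a *: u) v = a * dotp u v.
Proof. by rewrite mulr_sumr; apply: eq_bigr => j _; rewrite mxE mulrA. Qed.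

Lemma dotpNl u v : dotp (- u) v = - dotp u v.
Proof. by rewrite -scaleN1r dotpZl mulN1r. Qed.

Lemma dotpDr u v w : dotp w (u + v) = dotp w u + dotp w v.
Proof. by rewrite !(dotpC w) dotpDl. Qed.

Lemma dotpZr (a : R) u v : dotp u (a *: v) = a * dotp u v.
Proof. by rewrite !(dotpC u) dotpZl. Qed.

Lemma dotpNr u v : dotp u (- v) = - dotp u v.
Proof. by rewrite !(dotpC u) dotpNl. Qed.

Lemma dotp0l v : dotp 0 v = 0.
Proof. by rewrite -(scale0r (0 : 'rV[R]_d)) dotpZl mul0r. Qed.

Lemma dotp_suml (I : Type) (r : seq I) (P : pred I) (z : I -> 'rV[R]_d) v :
  dotp (\sum_(i <- r | P i) z i) v = \sum_(i <- r | P i) dotp (z i) v.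
Proof.
by apply: (big_morph (fun u => dotp u v)) => [u w|]; [exact: dotpDl|exact: dotp0l].
Qed.

Definition dotpE := (dotpDl, dotpDr, dotpNl, dotpNr, dotpZl, dotpZr).

Definition sqn v := dotp v v.

Lemma sqn_ge0 v : 0 <= sqn v.
Proof. by apply: sumr_ge0 => j _; rewrite -expr2 sqr_ge0. Qed.

Lemma sqn0 : sqn 0 = 0.
Proof. exact: dotp0l. Qed.

Lemma sqnZ (a : R) v : sqn (a *: v) = a ^+ 2 * sqn v.
Proof. by rewrite /sqn !dotpE expr2 mulrA. Qed.

Lemma sqnN v : sqn (- v) = sqn v.
Proof. by rewrite /sqn !dotpE opprK. Qed.

Lemma sqnD u v : sqn (u + v) = sqn u + 2 * dotp u v + sqn v.
Proof. rewrite /sqn !dotpE (dotpC v u); ring. Qed.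

Lemma sqnB u v : sqn (u - v) = sqn u - 2 * dotp u v + sqn v.
Proof. rewrite /sqn !dotpE (dotpC v u); ring. Qed.

Lemma enorm_sqr v : enorm v ^+ 2 = sqn v.
Proof. by rewrite sqr_sqrtr // sqn_ge0. Qed.

(** Expand [sqn (a *: u - v) >= 0] and divide by [a]. This weighted form replaces Cauchy-Schwarz
    throughout. *)
Lemma dotp_young (a : R) u v : 0 < a ->
  2 * dotp u v <= a * sqn u + a^-1 * sqn v.
Proof.
move=> a0; have := sqn_ge0 (a *: u - v).
rewrite sqnB sqnZ dotpZl => h.
have -> : a * sqn u + a^-1 * sqn v = a^-1 * (a ^+ 2 * sqn u + sqn v).
  by field; rewrite gt_eqF.
rewrite ler_pdivlMl //; lra.
Qed.

Lemma dotp_le_sqn u v : 2 * dotp u v <= sqn u + sqn v.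
Proof. by have := dotp_young u v ltr01; rewrite invr1 !mul1r. Qed.

Lemma sqnD_le (a : R) u v : 0 < a ->
  sqn (u + v) <= (1 + a) * sqn u + (1 + a^-1) * sqn v.
Proof. by move=> a0; have := dotp_young u v a0; rewrite sqnD; lra. Qed.

Lemma sqnD2_le u v : sqn (u + v) <= 2 * sqn u + 2 * sqn v.
Proof. by have := dotp_le_sqn u v; rewrite sqnD; lra. Qed.

Lemma sqnB2_le u v : sqn (u - v) <= 2 * sqn u + 2 * sqn v.
Proof. by have := sqnD2_le u (- v); rewrite sqnN. Qed.

End InnerProduct.

(** * Variance identity and Jensen's inequality for weighted means *)

Section WeightedMeans.
Variables (R : realType) (d m : nat).
Implicit Types (w : 'I_m -> R) (z : 'I_m -> 'rV[R]_d).

(** The variance identity. It gives Jensen's inequality for [sqn], and later the exact amount of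
    squared norm lost by mixing. *)
Lemma sqn_wmean w z : \sum_j w j = 1 ->
  \sum_j w j * sqn (z j - \sum_k w k *: z k)
    = \sum_j w j * sqn (z j) - sqn (\sum_k w k *: z k).
Proof.
move=> w1; set a := \sum_k w k *: z k.
have ea : \sum_j w j * dotp (z j) a = sqn a.
  rewrite /sqn {2}/a dotp_suml; apply: eq_bigr => j _.
  by rewrite dotpZl.
rewrite (eq_bigr (fun j => w j * sqn (z j) - 2 * (w j * dotp (z j) a)
   + w j * sqn a)); last by move=> j _; rewrite sqnB; ring.
rewrite big_split /= -mulr_suml w1 sumrB -mulr_sumr ea; ring.
Qed.

Lemma sqn_wmean_le w z : (forall j, 0 <= w j) -> \sum_j w j = 1 ->
  sqn (\sum_k w k *: z k) <= \sum_j w j * sqn (z j).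
Proof.
move=> w0 w1; rewrite -subr_ge0 -sqn_wmean //.
by apply: sumr_ge0 => j _; rewrite mulr_ge0 // sqn_ge0.
Qed.

Variables (K : set 'rV[R]_d) (g : 'rV[R]_d -> R).
Hypotheses (Kcvx : cvx_set K) (gcvx : cvx_fun_on g K).

(** Induction on the list with weights that need not sum to one, normalised by their sum [s].
    Membership in [K] is carried along because convexity of [g] is only available inside [K]. *)
Let jensen_seq w z (r : seq 'I_m) :
  (forall j, 0 <= w j) -> (forall j, K (z j)) ->
  let s := \sum_(j <- r) w j in 0 < s ->
  K (s^-1 *: \sum_(j <- r) w j *: z j) /\
  s * g (s^-1 *: \sum_(j <- r) w j *: z j) <= \sum_(j <- r) w j * g (z j).
Proof.
move=> w0 Kz; elim: r => [|i r IH] /=; first by rewrite big_nil ltxx.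
rewrite !big_cons; set s := \sum_(j <- r) w j in IH *.
set a := \sum_(j <- r) w j *: z j in IH *.
move=> ws0; have s0 : 0 <= s by apply: sumr_ge0.
(* If the tail has total weight zero, all its weights vanish and the barycentre is [z i]. Otherwise
   it is a convex combination of [z i] and the barycentre of the tail. *)
have [sE|sN0] := eqVneq s 0.
  have rw0 : forall j, j \in r -> w j = 0.
    move=> j jr; apply/eqP.
    have := psumr_eq0 r (fun j (_ : xpredT j) => w0 j).
    rewrite -/s sE eqxx => /esym/allP/(_ _ jr) /=; exact.
  have -> : a = 0.
    by rewrite /a big_seq big1 // => j jr; rewrite rw0 // scale0r.
  have -> : \sum_(j <- r) w j * g (z j) = 0.
    by rewrite big_seq big1 // => j jr; rewrite rw0 // mul0r.
  rewrite sE !addr0 in ws0 *.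
  rewrite scalerA mulVf ?gt_eqF // scale1r; split => //.
have {sN0}s0 : 0 < s by rewrite lt_neqAle eq_sym sN0.
have [Ka ga] := IH s0.
set t := w i / (w i + s).
have t01 : 0 <= t <= 1.
  by rewrite /t divr_ge0 //= ?ler_pdivrMr // ?mul1r ?lerDl ltW.
have tE : (w i + s)^-1 *: (w i *: z i + a) = t *: z i + (1 - t) *: (s^-1 *: a).
  rewrite scalerDr !scalerA /t; congr (_ *: _ + _ *: _); first exact: mulrC.
  by field; rewrite !gt_eqF.
have Kt := Kcvx (Kz i) Ka t01.
rewrite tE; split => //.
have := gcvx (Kz i) Ka t01 Kt.
rewrite -(ler_pM2l ws0) => /le_trans; apply.
have -> : (w i + s) * (t * g (z i) + (1 - t) * g (s^-1 *: a))
    = w i * g (z i) + s * g (s^-1 *: a) by rewrite /t; field; rewrite gt_eqF.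
lra.
Qed.

Lemma jensen w z : (forall j, 0 <= w j) -> \sum_j w j = 1 ->
  (forall j, K (z j)) ->
  K (\sum_j w j *: z j) /\ g (\sum_j w j *: z j) <= \sum_j w j * g (z j).
Proof.
move=> w0 w1 Kz; have := jensen_seq (r := index_enum 'I_m) w0 Kz.
by rewrite /= w1 invr1 scale1r mul1r; apply.
Qed.

End WeightedMeans.

(** * Uniform bounds over finite families *)

Lemma finite_pos_lb (R : realType) (m : nat) (a : 'I_m -> R) :
  (forall i, 0 < a i) -> exists2 c, 0 < c & forall i, c <= a i.
Proof.
elim: m a => [|m IH] a a0; first by exists 1 => // -[].
have [c c0 hc] := IH (fun i => a (lift ord0 i)) (fun i => a0 _).
exists (Num.min c (a ord0)); first by rewrite lt_min c0 a0.
move=> i; case: (unliftP ord0 i) => [j ->|->]; rewrite ge_min ?hc ?lexx ?orbT //.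
Qed.

Lemma finite_ub (R : realType) (m : nat) (a : 'I_m -> R) :
  exists2 c, 0 < c & forall i, a i <= c.
Proof.
exists (1 + \sum_i `|a i|); first by rewrite ltr_pwDl // sumr_ge0.
move=> i; rewrite (bigD1 i) //= (le_trans (ler_norm _)) //.
by rewrite [1 + _]addrC -addrA lerDl addr_ge0 // sumr_ge0.
Qed.

(** * First-order calculus along segments of a convex set *)

Section Calculus.
Variables (R : realType) (d : nat).
Implicit Types (g : 'rV[R]_d -> R) (x y u v w : 'rV[R]_d).

Lemma derivable_expansion g x v (e : R) : derivable g x v -> 0 < e ->
  exists2 r : R, 0 < r & forall s, 0 < s < r ->
    `|g (x + s *: v) - g x - s * 'D_v g x| <= e * s.
Proof.
move=> /cvgrPdist_le /[apply] -[r /= r0 hr]; exists r => // s /andP[s0 sr].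
have /= := hr s; rewrite sub0r normrN gtr0_norm // gt_eqF // => /(_ sr isT).
set q := s^-1 *: _ => h.
have -> : g (x + s *: v) - g x - s * 'D_v g x = - (s * ('D_v g x - q)).
  by rewrite /q [s *: v + x]addrC /GRing.scale /=; field; rewrite gt_eqF.
by rewrite normrN normrM gtr0_norm // mulrC ler_wpM2r // ltW.
Qed.

Lemma is_derive_line g x v (t : R) : derivable g (x + t *: v) v ->
  is_derive t 1 (fun s : R => g (x + s *: v)) ('D_v g (x + t *: v)).
Proof.
move=> gv.
have E : (fun h : R => h^-1 *: (((fun s : R => g (x + s *: v)) \o shift t)
            (h *: (1 : R)) - g (x + t *: v)))
       = (fun h : R => h^-1 *: ((g \o shift (x + t *: v)) (h *: v)
            - g (x + t *: v))).
  apply/funext => h /=; congr (_ *: (g _ - _)).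
  by rewrite scalerDl /GRing.scale /= mulr1 addrCA.
by split; rewrite /derivable /derive E.
Qed.

Lemma mean_value (phi dphi : R -> R) :
  (forall t : R, 0 <= t <= 1 -> is_derive t 1 phi (dphi t)) ->
  exists2 t : R, 0 < t < 1 & phi 1 - phi 0 = dphi t.
Proof.
move=> h; have [| |t] := MVT (f := phi) (df := dphi) ltr01.
- by move=> t; rewrite in_itv /= => /andP[t0 t1]; apply: h; rewrite !ltW.
- apply: derivable_within_continuous => t; rewrite in_itv /= => ht.
  by have [] := h t ht.
- by rewrite in_itv /= subr0 mulr1 => ? ?; exists t.
Qed.

(** Gateaux differentiability with a linear derivative: all that restricting to lines and applying
    the mean value theorem requires. *)
Definition has_grad g x :=
  forall v, derivable g x v /\ 'D_v g x = dotp (grad g x) v.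

Lemma differentiable_has_grad g x : differentiable g x -> has_grad g x.
Proof.
move=> gx v; split; first exact: diff_derivable.
rewrite deriveE // {1}(row_sum_delta v) linear_sum /=.
by apply: eq_bigr => j _; rewrite linearZ /= !mxE deriveE // mulrC.
Qed.

Lemma has_grad_mvt g x v :
  (forall t : R, 0 <= t <= 1 -> has_grad g (x + t *: v)) ->
  exists2 t : R, 0 < t < 1 &
    g (x + v) - g x = dotp (grad g (x + t *: v)) v.
Proof.
move=> h.
have [|t t01] := @mean_value (fun s => g (x + s *: v))
   (fun s => dotp (grad g (x + s *: v)) v).
  by move=> t /h/(_ v)[? <-]; exact: is_derive_line.
by rewrite scale1r scale0r addr0 => ->; exists t.
Qed.

Lemma segment_in (K : set 'rV[R]_d) x y (t : R) :
  cvx_set K -> K x -> K y -> 0 <= t <= 1 -> K (x + t *: (y - x)).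
Proof.
move=> Kc Kx Ky t01; have := Kc _ _ _ Ky Kx t01.
by congr K; apply/rowP => j; rewrite !mxE; ring.
Qed.

(** Here [l] is the square of a Lipschitz constant, so that only squared norms occur and no square
    roots. *)
Definition sqlip (l : R) (h : 'rV[R]_d -> 'rV[R]_d) (K : set 'rV[R]_d) :=
  forall x y, K x -> K y -> sqn (h x - h y) <= l * sqn (x - y).

Lemma lip_sqlip (l : R) h K : lip_map_on l h K -> sqlip (l ^+ 2) h K.
Proof.
move=> H x y Kx Ky; have := H x y Kx Ky.
have n0 : 0 <= enorm (h x - h y) by exact: sqrtr_ge0.
rewrite -!enorm_sqr -exprMn => H'; rewrite ler_pXn2r // nnegrE //.
exact: le_trans H'.
Qed.

(** By the mean value theorem the left side is [dotp q v] with [q] a gradient difference along the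
    segment; bounding it by [sqn q + sqn v] gives the constant [l + 1], which is not sharp. *)
Lemma quadratic_bound g (K : set 'rV[R]_d) (l : R) x y :
  cvx_set K -> 0 <= l -> (forall z, K z -> has_grad g z) ->
  sqlip l (grad g) K -> K x -> K y ->
  `|g y - g x - dotp (grad g x) (y - x)| <= (l + 1) * sqn (y - x).
Proof.
move=> Kc l0 gg gl Kx Ky; set v := y - x.
have Kt t : 0 <= t <= 1 -> K (x + t *: v) by exact: segment_in.
have [t t01] := has_grad_mvt (fun t ht => gg _ (Kt t ht)).
rewrite {1}/v subrKC => ->; case/andP: t01 => t0 t1.
rewrite -dotpNl -dotpDl; set q := grad g _ - grad g x.
have hq : sqn q <= l * sqn v.
  apply: le_trans (gl _ _ (Kt t _) Kx) _; first by rewrite !ltW.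
  rewrite addrAC subrr add0r sqnZ; apply: ler_wpM2l => //.
  rewrite ler_piMl ?sqn_ge0 // expr_le1 // ltW //.
have h1 := dotp_le_sqn q v; have h2 := dotp_le_sqn (- q) v.
rewrite sqnN dotpNl in h2; have h3 := sqn_ge0 v; have h4 := sqn_ge0 q.
by rewrite ler_norml; apply/andP; split; nra.
Qed.

Lemma le_limit0 (a b c : R) : 0 <= c ->
  (forall t, 0 < t < 1 -> a <= b + t * c) -> a <= b.
Proof.
move=> c0 h; rewrite leNgt; apply/negP => ab.
(* A [t] small enough that [t * c] is less than [a - b]. *)
pose t := (a - b) / (2 * (a - b + c)).
have D0 : 0 < 2 * (a - b + c) by lra.
have tD : t * (2 * (a - b + c)) = a - b by rewrite /t divfK // gt_eqF.
have t0 : 0 < t by rewrite /t divr_gt0 // subr_gt0.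
have t1 : t < 1 by rewrite /t ltr_pdivrMr //; lra.
have := h t; rewrite t0 t1 => /(_ isT); nra.
Qed.

(** Compare the minimizer with [x + t (z - x)], divide by [t] and let [t] tend to 0: convexity
    handles [G], and [quadratic_bound] makes the remainder for [g] of order [t]. *)
Lemma minimizer_variational g G (K : set 'rV[R]_d) (l : R) x z :
  cvx_set K -> 0 <= l -> (forall z, K z -> has_grad g z) ->
  sqlip l (grad g) K -> cvx_fun_on G K -> K x ->
  (forall z, K z -> g x + G x <= g z + G z) ->
  K z -> G x <= dotp (grad g x) (z - x) + G z.
Proof.
move=> Kc l0 gg gl Gc Kx hmin Kz.
apply: (@le_limit0 _ _ ((l + 1) * sqn (z - x))).
  by rewrite mulr_ge0 ?sqn_ge0 ?addr_ge0.
move=> t /andP[t0 t1].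
have t01 : 0 <= t <= 1 by rewrite !ltW.
have Kt := segment_in Kc Kx Kz t01.
have := quadratic_bound Kc l0 gg gl Kx Kt.
rewrite (addrC x) addrK -(addrC x) dotpZr sqnZ ler_norml => /andP[_ hq].
have E : x + t *: (z - x) = t *: z + (1 - t) *: x.
  by apply/rowP => j; rewrite !mxE; ring.
have := Gc z x t Kz Kx t01; rewrite -E => /(_ Kt) hG.
have hm := hmin _ Kt.
rewrite -(ler_pM2l t0); rewrite expr2 in hq.
have -> : t * (dotp (grad g x) (z - x) + G z + t * ((l + 1) * sqn (z - x)))
  = t * dotp (grad g x) (z - x) + t * G z + (l + 1) * (t * t * sqn (z - x)).
  ring.
lra.
Qed.

(** The same limit [t -> 0] along the segment, now in the inequality that defines strong
    convexity. *)
Lemma strong_convexity_first_order g (K : set 'rV[R]_d) (l mu : R) x y :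
  cvx_set K -> 0 <= l -> 0 <= mu -> (forall z, K z -> has_grad g z) ->
  sqlip l (grad g) K -> strongly_cvx_on mu g K -> K x -> K y ->
  g x + dotp (grad g x) (y - x) + mu / 2 * sqn (y - x) <= g y.
Proof.
move=> Kc l0 mu0 gg gl gc Kx Ky.
apply: (@le_limit0 _ _ ((l + 1 + mu / 2) * sqn (y - x))).
  by rewrite mulr_ge0 ?sqn_ge0 ?addr_ge0 ?divr_ge0.
move=> t /andP[t0 t1].
have t01 : 0 <= t <= 1 by rewrite !ltW.
have Kt := segment_in Kc Kx Ky t01.
have := quadratic_bound Kc l0 gg gl Kx Kt.
rewrite (addrC x) addrK -(addrC x) dotpZr sqnZ ler_norml => /andP[hq _].
have E : x + t *: (y - x) = t *: y + (1 - t) *: x.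
  by apply/rowP => j; rewrite !mxE; ring.
have := gc y x t Ky Kx t01; rewrite -E enorm_sqr => hs.
rewrite -(ler_pM2l t0); rewrite expr2 in hq.
set q := dotp _ _ in hq *; set s := sqn _ in hs hq *.
have -> : t * (g y + t * ((l + 1 + mu / 2) * s))
  = t * g y + (l + 1) * (t * t * s) + mu / 2 * t * t * s by ring.
have E2 : mu / 2 * t * (1 - t) * s = mu / 2 * t * s - mu / 2 * t * t * s.
  by ring.
rewrite E2 in hs; have E3 : (1 - t) * g x = g x - t * g x by ring.
have -> : t * (g x + q + mu / 2 * s) = t * g x + t * q + mu / 2 * t * s by ring.
lra.
Qed.

Lemma strong_convexity_monotone g (K : set 'rV[R]_d) (l mu : R) x y :
  cvx_set K -> 0 <= l -> 0 <= mu -> (forall z, K z -> has_grad g z) ->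
  sqlip l (grad g) K -> strongly_cvx_on mu g K -> K x -> K y ->
  mu * sqn (y - x) <= dotp (grad g y - grad g x) (y - x).
Proof.
move=> Kc l0 mu0 gg gl gc Kx Ky.
have h1 := strong_convexity_first_order Kc l0 mu0 gg gl gc Kx Ky.
have := strong_convexity_first_order Kc l0 mu0 gg gl gc Ky Kx.
rewrite -opprB sqnN dotpNr => h2; rewrite dotpDl dotpNl; lra.
Qed.

End Calculus.

(** * Hessian bounds and their consequences for gradients *)

Section SecondOrder.
Variables (R : realType) (d : nat).
Implicit Types (g : 'rV[R]_d -> R) (x y u v w : 'rV[R]_d).

(** For a Hessian, [u] is the direction of differentiation and [v] is paired with the gradient. *)
Definition bform (H : 'M[R]_d) u v : R := (u *m H *m v^T) 0 0.

Lemma bformE H u v : bform H u v = \sum_j (\sum_i u 0 i * H i j) * v 0 j.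
Proof. by rewrite /bform mxE; apply: eq_bigr => j _; rewrite !mxE. Qed.

Lemma bform0r H u : bform H u 0 = 0.
Proof. by rewrite /bform trmx0 mulmx0 mxE. Qed.

Lemma has_grad_near_eq g h x :
  (\near x, g x = h x) -> has_grad h x -> has_grad g x.
Proof.
move=> gh hx v; have [dh eh] := hx v.
split; first by apply: near_eq_derivable dh; apply: filterS gh => z ->.
rewrite (near_eq_derive _ gh) eh; apply: eq_bigr => j _.
by rewrite !mxE (near_eq_derive _ gh).
Qed.

Lemma is_derive_grad g x u v :
  (forall j, has_grad (fun z => derive g z (ebasis R j)) x) ->
  is_derive x v (fun z => dotp (grad g z) u) (bform (hess g x) v u).
Proof.
move=> gx.
have -> : (fun z => dotp (grad g z) u)
    = \sum_(j < d) (u 0 j \*: (fun z => derive g z (ebasis R j))).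
  apply/funext => z; rewrite fct_sumE; apply: eq_bigr => j _.
  by rewrite mxE mulrC.
have hj j : is_derive x v (fun z => derive g z (ebasis R j))
                          (\sum_i v 0 i * hess g x i j).
  have [h1 h2] := gx j v.
  split=> //; rewrite h2; apply: eq_bigr => i _.
  by rewrite !mxE mulrC.
apply: (is_derive_eq (is_derive_sum (fun j => is_deriveZ (u 0 j) (hj j)))).
by rewrite bformE; apply: eq_bigr => j _; rewrite mulrC.
Qed.

(** Convexity on the segment gives [s (g (x + v) - g x) >= g (x + s v) - g x]; the first-order
    expansion of the right side at a small [s] yields the slope up to [e]. *)
Lemma convex_above_tangent g (S : set 'rV[R]_d) x v :
  has_grad g x -> cvx_fun_on g S ->
  (forall s : R, 0 <= s <= 1 -> S (x + s *: v)) ->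
  g x + dotp (grad g x) v <= g (x + v).
Proof.
move=> gx gc Sx; apply/ler_addgt0Pr => e e0.
have [gv <-] := gx v.
have [r r0 hr] := derivable_expansion gv e0.
pose s := Num.min (r / 2) (1 / 2).
have s0 : 0 < s by rewrite lt_min; apply/andP; split; lra.
have sr : s < r by rewrite /s gt_min; apply/orP; left; lra.
have s1 : s < 1 by rewrite /s gt_min; apply/orP; right; lra.
have := hr s; rewrite s0 sr => /(_ isT); rewrite ler_norml => /andP[h _].
have s01 : 0 <= s <= 1 by rewrite !ltW.
have E : x + s *: v = s *: (x + v) + (1 - s) *: x.
  by apply/rowP => j; rewrite !mxE; ring.
have := gc (x + v) x s; rewrite -E => /(_ _ _ s01 (Sx s s01)).
have S1 := Sx 1; have S0 := Sx 0; rewrite scale1r in S1.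
rewrite scale0r addr0 in S0; rewrite lexx ler01 /= in S0 S1.
move=> /(_ (S1 (lexx 1)) (S0 isT)) h'.
by rewrite -(ler_pM2l s0); lra.
Qed.

Lemma open_two_directions (O : set 'rV[R]_d) x u v : open O -> O x ->
  exists2 r : R, 0 < r & forall s t : R, 0 <= s <= r -> 0 <= t <= r ->
    O (x + s *: u + t *: v).
Proof.
rewrite openE => /[apply] /nbhs_ballP[r /= r0 hr].
pose D := `|u| + `|v| + 1.
have D0 : 0 < D by rewrite ltr_wpDl // addr_ge0.
exists (r / (2 * D)); first by rewrite divr_gt0 // mulr_gt0.
move=> s t /andP[s0 s1] /andP[t0 t1]; apply: hr.
rewrite -ball_normE /= -addrA opprD addrA subrr sub0r normrN.
apply: le_lt_trans (ler_normD _ _) _; rewrite !normrZ !ger0_norm //.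
apply: (@le_lt_trans _ _ (r / (2 * D) * (`|u| + `|v|))).
  by rewrite mulrDr lerD // ler_wpM2r.
rewrite mulrAC ltr_pdivrMr ?mulr_gt0 // ltr_pM2l // /D.
have := normr_ge0 u; have := normr_ge0 v; lra.
Qed.

(* Compare [g (x + t (h + u))] with its lower bounds by the tangent planes at
   [x] and at [x + t h], and with its upper bound by the tangent plane at
   [x + t (h + u)] itself, to second order in [t]; no symmetry of the Hessian
   is needed. *)
Lemma convex_bform_le g (O : set 'rV[R]_d) x h u :
  open O -> twice_diff_on_set g O -> cvx_fun_on g O -> O x ->
  bform (hess g x) h u <= qform (hess g x) (h + u).
Proof.
move=> oO g2 gc Ox.
have gO z : O z -> has_grad g z.
  by move=> /g2[? _]; exact: differentiable_has_grad.
have g2x j := differentiable_has_grad ((g2 x Ox).2 j); set H := hess g x.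
apply/ler_addgt0Pr => e0 e0_gt0; pose e := e0 / 2.
have e_gt0 : 0 < e by rewrite /e; lra.
have /= d1 := is_derive_grad (h + u) (h + u) g2x.
have /= d2 := is_derive_grad u h g2x.
have [r1 r1_gt0 H1] := derivable_expansion (@ex_derive _ _ _ _ _ _ _ d1) e_gt0.
have [r2 r2_gt0 H2] := derivable_expansion (@ex_derive _ _ _ _ _ _ _ d2) e_gt0.
rewrite (@derive_val _ _ _ _ _ _ _ d1) in H1.
rewrite (@derive_val _ _ _ _ _ _ _ d2) in H2.
have [r3 r3_gt0 HO] := open_two_directions h u oO Ox.
pose t := Num.min (r1 / 2) (Num.min (r2 / 2) r3).
have t0 : 0 < t by rewrite !lt_min r3_gt0 !divr_gt0.
have tr1 : t < r1 by rewrite /t gt_min; apply/orP; left; lra.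
have tr2 : t < r2 by rewrite /t !gt_min; apply/orP; right; apply/orP; left; lra.
have tr3 : t <= r3 by rewrite /t !ge_min lexx !orbT.
have Ot (a b : R) : 0 <= a <= t -> 0 <= b <= t -> O (x + a *: h + b *: u).
  by move=> /andP[? ?] /andP[? ?]; apply: HO; apply/andP; split => //;
    exact: le_trans tr3.
have t0t : 0 <= t <= t by rewrite lexx andbT ltW.
have z0t : 0 <= (0 : R) <= t by rewrite lexx ltW.
have st (s : R) : 0 <= s <= 1 -> 0 <= s * t <= t.
  move=> /andP[s0 s1]; apply/andP; split; first by rewrite mulr_ge0 // ltW.
  by rewrite ler_piMl // ltW.
set p := x + t *: h + t *: u.
have pE : x + t *: (h + u) = p by rewrite scalerDr addrA.
have Oxh : O (x + t *: h) by have := Ot t 0 t0t z0t; rewrite scale0r addr0.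
have T1 : g x + t * dotp (grad g x) h <= g (x + t *: h).
  rewrite -dotpZr; apply: (convex_above_tangent (gO _ Ox) gc) => s /st hs.
  by have := Ot _ 0 hs z0t; rewrite scale0r addr0 scalerA.
have T2 : g (x + t *: h) + t * dotp (grad g (x + t *: h)) u <= g p.
  rewrite -dotpZr; apply: (convex_above_tangent (gO _ Oxh) gc) => s /st hs.
  by have := Ot _ _ t0t hs; rewrite scalerA.
have T3 : g p - t * dotp (grad g p) (h + u) <= g x.
  have -> : x = p + (- t) *: (h + u).
    by rewrite -pE scaleNr addrK.
  rewrite -mulNr -dotpZr; apply: (convex_above_tangent (gO _ (Ot _ _ t0t t0t)) gc).
  move=> s /andP[s0 s1]; have hs : 0 <= (1 - s) * t <= t by apply: st; lra.
  have := Ot _ _ hs hs; congr O.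
  by apply/rowP => j; rewrite !mxE; ring.
have := H1 t; rewrite t0 tr1 => /(_ isT); rewrite pE ler_norml => /andP[_ h1].
have := H2 t; rewrite t0 tr2 => /(_ isT); rewrite ler_norml => /andP[h2 _].
rewrite -(ler_pM2l t0).
have hs : dotp (grad g x) (h + u) = dotp (grad g x) h + dotp (grad g x) u.
  exact: dotpDr.
rewrite hs in h1.
rewrite -[qform H _]/(bform H (h + u) (h + u)).
set q := bform H (h + u) (h + u) in h1 *; set b := bform H h u in h2 *.
rewrite -(ler_pM2l t0).
have {}h1 : t * dotp (grad g p) (h + u) <=
    t * dotp (grad g x) h + t * dotp (grad g x) u + t * (t * q) + t * (t * e).
  by rewrite -!mulrDr ler_pM2l //; lra.
have {}h2 : t * dotp (grad g x) u + t * (t * b) - t * (t * e) <=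
    t * dotp (grad g (x + t *: h)) u.
  by rewrite -mulrDr -mulrBr ler_pM2l //; lra.
have -> : t * (t * (q + e0)) = t * (t * q) + t * (t * e) + t * (t * e).
  by rewrite /e; field.
lra.
Qed.

(** The gradient is tested against a fixed [u] to make it scalar; the intermediate point depends on
    [u]. *)
Lemma grad_mvt g x v u :
  (forall (t : R) j, 0 <= t <= 1 ->
    has_grad (fun z => derive g z (ebasis R j)) (x + t *: v)) ->
  exists2 t : R, 0 < t < 1 &
    dotp (grad g (x + v)) u - dotp (grad g x) u
      = bform (hess g (x + t *: v)) v u.
Proof.
move=> h.
have [|t t01] := @mean_value R (fun s => dotp (grad g (x + s *: v)) u)
   (fun s => bform (hess g (x + s *: v)) v u).
  move=> t t01; have := is_derive_grad u v (fun j => h t j t01) => dt.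
  have := is_derive_line (@ex_derive _ _ _ _ _ _ _ dt).
  by rewrite (@derive_val _ _ _ _ _ _ _ dt).
by rewrite scale1r scale0r addr0 => ->; exists t.
Qed.

(** Test the gradient difference [w] against [u = w / (4 M)]. The mean value theorem gives
    [bform H v u = sqn w / (4 M)] at an intermediate Hessian [H], and [convex_bform_le] bounds this
    by [M sqn (v + u) <= 2 M sqn v + sqn w / (8 M)]. Half of the left side survives. *)
Lemma convex_grad_sqlip g (K O : set 'rV[R]_d) (M : R) :
  open O -> twice_diff_on_set g O -> cvx_fun_on g O -> K `<=` O ->
  cvx_set K -> 0 < M ->
  (forall x v, K x -> qform (hess g x) v <= M * sqn v) ->
  sqlip (16 * M ^+ 2) (grad g) K.
Proof.
move=> oO g2 gc KO Kc M0 gM y x Ky Kx.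
pose v := y - x; pose w := grad g y - grad g x.
have [t j t01|t /andP[t0 t1]] := @grad_mvt g x v ((4 * M)^-1 *: w).
  exact/differentiable_has_grad/(g2 _ (KO _ (segment_in Kc Kx Ky t01))).2.
have Kt : K (x + t *: v) by apply: segment_in; rewrite // !ltW.
rewrite [x + v]subrKC -dotpNl -dotpDl -/w dotpZr => E.
have := convex_bform_le v ((4 * M)^-1 *: w) oO g2 gc (KO _ Kt).
rewrite -E => /le_trans/(_ (gM _ _ Kt)).
have := sqnD2_le v ((4 * M)^-1 *: w).
rewrite -(ler_pM2l M0) => h /le_trans/(_ h).
rewrite sqnZ -/(sqn w) -/v -/w => {}h.
have E2 : (4 * M)^-1 * sqn w - M * (2 * ((4 * M)^-1 ^+ 2 * sqn w))
   = (8 * M)^-1 * sqn w by field; rewrite gt_eqF.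
have : (8 * M)^-1 * sqn w <= M * (2 * sqn v) by rewrite -E2; lra.
rewrite ler_pdivrMl ?mulr_gt0 // => /le_trans; apply.
by rewrite le_eqVlt; apply/orP; left; apply/eqP; ring.
Qed.

Lemma strong_convexity_of_hess g (K : set 'rV[R]_d) (mu : R) x y :
  (forall z, K z -> has_grad g z) ->
  (forall z j, K z -> has_grad (fun z => derive g z (ebasis R j)) z) ->
  cvx_set K -> 0 <= mu ->
  (forall x v, K x -> mu * sqn v <= qform (hess g x) v) ->
  K x -> K y ->
  g x + dotp (grad g x) (y - x) + mu / 4 * sqn (y - x) <= g y.
Proof.
move=> gK g2 Kc mu0 gmu Kx Ky; set v := y - x.
have Kt (t : R) : 0 <= t <= 1 -> K (x + t *: v) by exact: segment_in.
(* The slope along the segment grows at rate at least [mu * sqn v]: apply [grad_mvt] over [t *: v],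
   tested against [t *: v], and cancel [t] twice. *)
have mono (t : R) : 0 <= t <= 1 -> 
    dotp (grad g x) v + t * (mu * sqn v) <= dotp (grad g (x + t *: v)) v.
  move=> /andP[]; rewrite le_eqVlt => /predU1P[<- _|t0 t1].
    by rewrite scale0r mul0r !addr0.
  have tt (s : R) : 0 <= s <= 1 -> K (x + s *: (t *: v)).
    move=> /andP[s0 s1]; rewrite scalerA; apply: Kt.
    by apply/andP; split; nra.
  have [s j s01|s /andP[s0 s1]] := @grad_mvt g x (t *: v) (t *: v).
    exact: g2 (tt _ s01).
  rewrite !dotpZr => E.
  have s01 : 0 <= s <= 1 by rewrite !ltW.
  have := gmu _ (t *: v) (tt s s01).
  rewrite /qform -/(bform _ _ _) -E sqnZ -(ler_pM2l t0) => h.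
  rewrite -(ler_pM2l t0) -(ler_pM2l t0).
  have -> : t * (t * (dotp (grad g x) v + t * (mu * sqn v)))
    = t * (t * dotp (grad g x) v) + t * (mu * (t ^+ 2 * sqn v)) by ring.
  by rewrite mulrBr in h; lra.
(* The mean value theorem on each half of the segment. On the second half the parameter is at least
   1/2, so the slope gains at least [q / 2] over length 1/2; this yields [mu / 4]. *)
pose v2 := 2^-1 *: v; pose p := x + v2.
have pE (a : R) : p + a *: v2 = x + (2^-1 + a * 2^-1) *: v.
  by apply/rowP => j; rewrite /p /v2 !mxE; ring.
have [t1 t101|t /andP[t0 t1] E1] := @has_grad_mvt _ _ g x v2.
  rewrite scalerA; apply/gK/Kt; lra.
have [t2 t201|s /andP[s0 s1] E2] := @has_grad_mvt _ _ g p v2.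
  by rewrite pE; apply/gK/Kt; lra.
have yE : p + v2 = y.
  by apply/rowP => j; rewrite !mxE; field.
have m1 : 0 <= t * 2^-1 <= 1 by lra.
have m2 : 0 <= 2^-1 + s * 2^-1 <= 1 by lra.
have := mono _ m1; have := mono _ m2.
rewrite yE in E2; rewrite dotpZr -/p in E1; rewrite dotpZr in E2.
rewrite scalerA in E1; rewrite pE in E2.
have q0 : 0 <= mu * sqn v by rewrite mulr_ge0 ?sqn_ge0.
rewrite -/p in E2; set A := dotp _ v in E2 *; set B := dotp _ v in E1 *.
move=> hA hB; set q := mu * sqn v in hA hB q0 *.
have -> : mu / 4 * sqn v = q / 4 by rewrite /q; ring.
have : 0 <= t * q by rewrite mulr_ge0 // ltW.
have : 0 <= s * q by rewrite mulr_ge0 // ltW.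
lra.
Qed.

End SecondOrder.

(** * Derivatives of the average of the local functions *)

Section Averages.
Variables (R : realType) (d m : nat) (O : set 'rV[R]_d)
  (f : 'I_m -> 'rV[R]_d -> R).
Hypotheses (oO : open O) (f2 : forall i, twice_diff_on_set (f i) O).

Definition favg (z : 'rV[R]_d) : R := m%:R^-1 * \sum_(i < m) f i z.

Let avgE (h : 'I_m -> 'rV[R]_d -> R) :
  (fun z => m%:R^-1 * \sum_(i < m) h i z) = m%:R^-1 \*: \sum_(i < m) h i.
Proof. by apply/funext => z /=; rewrite fct_sumE. Qed.

Let differentiable_avg (h : 'I_m -> 'rV[R]_d -> R) x :
  (forall i, differentiable (h i) x) ->
  differentiable (fun z => m%:R^-1 * \sum_(i < m) h i z) x.
Proof.
by move=> hx; rewrite avgE; apply: differentiableZ; apply: differentiable_sum.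
Qed.

Let derive_avg (h : 'I_m -> 'rV[R]_d -> R) x v :
  (forall i, differentiable (h i) x) ->
  derive (fun z => m%:R^-1 * \sum_(i < m) h i z) x v
    = m%:R^-1 * \sum_(i < m) derive (h i) x v.
Proof.
move=> hx; have hd i : derivable (h i) x v by exact: diff_derivable.
by rewrite avgE deriveZ ?derive_sum //; exact: derivable_sum.
Qed.

(** Second derivatives at [x] depend on the first ones in a neighbourhood; openness of [O] provides
    one. *)
Let near_partial x j : O x ->
  \near x, derive favg x (ebasis R j)
    = m%:R^-1 * \sum_(i < m) derive (f i) x (ebasis R j).
Proof.
move=> Ox; near=> z; apply: derive_avg => i.
suff Oz : O z by exact: (f2 i Oz).1.
by near: z; exact: open_nbhs_nbhs.
Unshelve. all: by end_near.
Qed.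

Lemma grad_favg x : O x -> grad favg x = m%:R^-1 *: \sum_(i < m) grad (f i) x.
Proof.
move=> Ox; apply/rowP => j; rewrite !mxE summxE.
rewrite derive_avg; last by move=> i; exact: (f2 i Ox).1.
by congr (_ * _); apply: eq_bigr => i _; rewrite mxE.
Qed.

Lemma hess_favg x : O x -> hess favg x = m%:R^-1 *: \sum_(i < m) hess (f i) x.
Proof.
move=> Ox; apply/matrixP => k j; rewrite !mxE summxE.
rewrite (near_eq_derive _ (near_partial j Ox)) derive_avg.
  by congr (_ * _); apply: eq_bigr => i _; rewrite mxE.
by move=> i; exact: (f2 i Ox).2.
Qed.

Lemma has_grad_favg x : O x -> has_grad favg x.
Proof.
move=> Ox; apply: differentiable_has_grad.
by apply: differentiable_avg => i; exact: (f2 i Ox).1.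
Qed.

Lemma has_grad_partial_favg x j :
  O x -> has_grad (fun z => derive favg z (ebasis R j)) x.
Proof.
move=> Ox; apply: has_grad_near_eq (near_partial j Ox) _.
apply: differentiable_has_grad.
by apply: differentiable_avg => i; exact: (f2 i Ox).2.
Qed.

Lemma qform_favg x v : O x ->
  qform (hess favg x) v = m%:R^-1 * \sum_(i < m) qform (hess (f i) x) v.
Proof.
move=> Ox; rewrite hess_favg // /qform -scalemxAr -scalemxAl mxE; congr (_ * _).
by rewrite mulmx_sumr mulmx_suml summxE.
Qed.

End Averages.

(** * Contraction of deviations from the mean under mixing *)

Section Consensus.
Variables (R : realType) (d m : nat) (E : rel 'I_m) (W : 'M[R]_m).
Hypotheses (m_gt0 : (0 < m)%N) (hE : connected_undirected E)
  (hW : weight_matrix E W).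
Implicit Types z e : 'I_m -> 'rV[R]_d.

Definition mix z i := \sum_j W i j *: z j.
Definition mean z := m%:R^-1 *: \sum_j z j.
Definition dev z i := z i - mean z.
Definition ssq z := \sum_i sqn (z i).

Let mR_gt0 : 0 < m%:R :> R. Proof. by rewrite ltr0n. Qed.
Let mR_neq0 : m%:R != 0 :> R. Proof. by rewrite gt_eqF. Qed.

Let W_ge0 i j : 0 <= W i j. Proof. by have [_ [_ []]] := hW. Qed.
Let W_row i : \sum_j W i j = 1. Proof. by have [_ [_ [_ []]]] := hW. Qed.
Let W_col j : \sum_i W i j = 1. Proof. by have [_ [_ [_ []]]] := hW. Qed.

Lemma ssq_ge0 z : 0 <= ssq z.
Proof. by apply: sumr_ge0 => i _; exact: sqn_ge0. Qed.

Lemma ssqD_le (a : R) z e : 0 < a ->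
  ssq (fun i => z i + e i) <= (1 + a) * ssq z + (1 + a^-1) * ssq e.
Proof.
move=> a0; rewrite !mulr_sumr -big_split /=.
by apply: ler_sum => i _; exact: sqnD_le.
Qed.

Lemma ssqD2_le z e : ssq (fun i => z i + e i) <= 2 * ssq z + 2 * ssq e.
Proof. by have := ssqD_le z e ltr01; rewrite invr1. Qed.

Lemma ssqZ (a : R) z : ssq (fun i => a *: z i) = a ^+ 2 * ssq z.
Proof. by rewrite mulr_sumr; apply: eq_bigr => i _; rewrite sqnZ. Qed.

Lemma sum_mix z : \sum_i mix z i = \sum_j z j.
Proof.
rewrite exchange_big /=; apply: eq_bigr => j _.
by rewrite -scaler_suml W_col scale1r.
Qed.

Lemma mean_mix z : mean (mix z) = mean z.
Proof. by rewrite /mean sum_mix. Qed.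

Lemma mixD z e : mix (fun i => z i + e i) = (fun i => mix z i + mix e i).
Proof.
apply/funext => i; rewrite -big_split; apply: eq_bigr => j _ /=.
exact: scalerDr.
Qed.

Lemma meanD z e : mean (fun i => z i + e i) = mean z + mean e.
Proof. by rewrite /mean big_split scalerDr. Qed.

Lemma devD z e : dev (fun i => z i + e i) = (fun i => dev z i + dev e i).
Proof. by apply/funext => i; rewrite /dev meanD opprD addrACA. Qed.

Lemma mix_const (c : 'rV[R]_d) i : mix (fun=> c) i = c.
Proof. by rewrite /mix -scaler_suml W_row scale1r. Qed.

Lemma mix_dev z : mix (dev z) = (fun i => mix z i - mean z).
Proof.
by rewrite /dev mixD; apply/funext => i; rewrite mix_const.
Qed.

Lemma dev_mix z : dev (mix z) = mix (dev z).
Proof. by rewrite mix_dev /dev mean_mix. Qed.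

Lemma sum_dev z : \sum_i dev z i = 0.
Proof.
rewrite sumrB sumr_const card_ord -(scaler_nat _ (mean z)) /mean scalerA.
by rewrite divff // scale1r subrr.
Qed.

Let w1 : \sum_(j < m) m%:R^-1 = 1 :> R.
Proof. by rewrite sumr_const card_ord -(mulr_natl (m%:R^-1)) divff. Qed.

Lemma ssq_dev_le z : ssq (dev z) <= ssq z.
Proof.
have := sqn_wmean z w1; rewrite -scaler_sumr -/(mean z) -!mulr_sumr => h.
rewrite -(ler_pM2l (x := m%:R^-1)) ?invr_gt0 // h lerBlDr lerDl.
exact: sqn_ge0.
Qed.

(** The loss in Jensen's inequality at row [i]. It is a weighted variance, and since the columns of
    [W] sum to one the gaps add up to the squared norm lost by mixing. *)
Let gap z i := \sum_j W i j * sqn (z j) - sqn (mix z i).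

Let gapE z i : gap z i = \sum_j W i j * sqn (z j - mix z i).
Proof. by rewrite sqn_wmean. Qed.

Let gap_ge0 z i : 0 <= gap z i.
Proof. by rewrite gapE; apply: sumr_ge0 => j _; rewrite mulr_ge0 ?sqn_ge0. Qed.

Let sum_gap z : \sum_i gap z i = ssq z - ssq (mix z).
Proof.
rewrite sumrB exchange_big /=; congr (_ - _); apply: eq_bigr => j _.
by rewrite -mulr_suml W_col mul1r.
Qed.

Lemma ssq_mix_le z : ssq (mix z) <= ssq z.
Proof. by rewrite -subr_ge0 -sum_gap; apply: sumr_ge0. Qed.

Let gap_term z i j : W i j * sqn (z j - mix z i) <= ssq z - ssq (mix z).
Proof.
rewrite -sum_gap (bigD1 i) //= gapE (bigD1 j) //= -addrA lerDl addr_ge0 //.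
  by apply: sumr_ge0 => k _; rewrite mulr_ge0 ?sqn_ge0.
exact: sumr_ge0.
Qed.

(** Both [z a] and [z b] are close to [mix z a], because [W a a] and [W a b] are positive. *)
Let edge_gap a b : E a b -> exists2 C : R, 0 <= C &
  forall z, sqn (z a - z b) <= C * (ssq z - ssq (mix z)).
Proof.
move=> Eab; have [E_irr _] := hE; have [Wd [We _]] := hW.
have ab : a != b by apply: contraTneq Eab => ->; rewrite E_irr.
have Wab := (We a b ab).1 Eab; have Waa := Wd a.
exists (2 * (W a a)^-1 + 2 * (W a b)^-1).
  by rewrite addr_ge0 // mulr_ge0 // invr_ge0.
move=> z; set D := ssq z - _.
have ha : sqn (z a - mix z a) <= (W a a)^-1 * D.
  by rewrite ler_pdivlMl //; exact: gap_term.
have hb : sqn (z b - mix z a) <= (W a b)^-1 * D.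
  by rewrite ler_pdivlMl //; exact: gap_term.
have := sqnB2_le (z a - mix z a) (z b - mix z a).
by rewrite opprB addrA subrK; lra.
Qed.

(** Chain the edge bounds along a path of the connected graph; the constant is independent of
    [z]. *)
Let pair_gap a b : exists2 C : R, 0 <= C &
  forall z, sqn (z a - z b) <= C * (ssq z - ssq (mix z)).
Proof.
have [_ [_ /(_ a b)/connectP[p]]] := hE.
elim: p a => [|c p IH] a /=.
  move=> _ ->; exists 0 => // z; by rewrite subrr sqn0 mul0r.
move=> /andP[/edge_gap[C1 C10 h1] /IH/[apply] -[C2 C20 h2]].
exists (2 * C1 + 2 * C2); first by rewrite addr_ge0 // mulr_ge0.
move=> z; have := sqnD2_le (z a - z c) (z c - z b).
by rewrite addrA subrK; have := h1 z; have := h2 z; lra.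
Qed.

(** When the sum is zero, [z i] is the average of the differences [z i - z j], so [pair_gap] bounds
    [ssq z] by [D] times the norm lost. Hence the factor [1 - D^-1]; the summand 1 in [D] keeps it
    nonnegative. *)
Lemma mix_contraction : exists2 rho : R, 0 <= rho < 1 &
  forall z, \sum_i z i = 0 -> ssq (mix z) <= rho * ssq z.
Proof.
pose C i j := projT1 (cid2 (pair_gap i j)).
have C0 i j : 0 <= C i j by rewrite /C; case: cid2.
have hC i j z : sqn (z i - z j) <= C i j * (ssq z - ssq (mix z)).
  by rewrite /C; case: cid2.
pose D := 1 + \sum_i \sum_j m%:R^-1 * C i j.
have D1 : 1 <= D.
  rewrite lerDl; apply: sumr_ge0 => i _; apply: sumr_ge0 => j _.
  by rewrite mulr_ge0 // invr_ge0 ltW.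
have D0 : 0 < D by exact: lt_le_trans D1.
exists (1 - D^-1); first by rewrite subr_ge0 invf_le1 // D1 /= gtrBl invr_gt0.
move=> z z0; set g := ssq z - ssq (mix z).
have g0 : 0 <= g by rewrite subr_ge0 ssq_mix_le.
suff : ssq z <= D * g.
  by rewrite -ler_pdivrMl // /g mulrBl mul1r; lra.
have w0 (j : 'I_m) : 0 <= m%:R^-1 :> R by rewrite invr_ge0 ltW.
rewrite mulrDl mul1r mulr_suml; apply: ler_wpDl => //.
apply: ler_sum => i _.
have E1 : z i = \sum_j m%:R^-1 *: (z i - z j).
  rewrite -scaler_sumr sumrB z0 subr0 sumr_const card_ord -(scaler_nat _ (z i)).
  by rewrite scalerA mulVf // scale1r.
rewrite {1}E1; apply: le_trans (sqn_wmean_le _ w0 w1) _.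
rewrite mulr_suml; apply: ler_sum => j _.
by rewrite -mulrA ler_wpM2l.
Qed.

Lemma perturbed_consensus : exists rho C : R, [/\ 0 < rho < 1, 0 < C &
  forall z e, ssq (dev (mix (fun i => z i + e i)))
    <= rho * ssq (dev z) + C * ssq e].
Proof.
have [r /andP[r0 r1] hr] := mix_contraction.
(* With this Young weight, [r * (1 + a) <= (1 + r) / 2 < 1]. *)
pose a := (1 - r) / 2; have a0 : 0 < a by rewrite /a; lra.
exists ((1 + r) / 2), (1 + a^-1); split; first by apply/andP; split; lra.
  by rewrite addr_gt0 // invr_gt0.
move=> z e; rewrite dev_mix; apply: le_trans (hr _ (sum_dev _)) _.
rewrite devD; have h1 := ssqD_le (dev z) (dev e) a0.
have h2 := ssq_dev_le e; have X0 := ssq_ge0 (dev z).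
set X := ssq (dev z) in h1 X0 *; have e0 := ssq_ge0 (dev e).
have b0 : 0 < a^-1 by rewrite invr_gt0.
apply: le_trans (ler_wpM2l r0 h1) _; rewrite mulrDr; apply: lerD.
  by rewrite mulrA ler_wpM2r //; rewrite /a; nra.
apply: (@le_trans _ _ ((1 + a^-1) * ssq (dev e))); last first.
  by rewrite ler_wpM2l // addr_ge0 // ltW.
rewrite ler_piMl ?mulr_ge0 ?addr_ge0 // ltW //.
Qed.

End Consensus.

(** * Progress of one agent in a local step *)

Section AgentProgress.
Variables (R : realType) (d : nat) (K : set 'rV[R]_d) (F G : 'rV[R]_d -> R)
  (gF : 'rV[R]_d -> 'rV[R]_d) (mu lF t lt : R).
Hypotheses (Kcvx : cvx_set K) (Fcvx : cvx_fun_on F K) (Gcvx : cvx_fun_on G K).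
Hypotheses (mu_gt0 : 0 < mu) (lF_ge0 : 0 <= lF) (t_gt0 : 0 < t)
  (lt_ge0 : 0 <= lt).
Hypothesis F_lower : forall x z, K x -> K z ->
  F x + dotp (gF x) (z - x) + mu * sqn (z - x) <= F z.
Hypothesis F_upper : forall x z, K x -> K z ->
  F z <= F x + dotp (gF x) (z - x) + (lF + 1) * sqn (z - x).
Hypothesis gF_lip : sqlip lF gF K.

(* The step combines [descent] and [gap_bound] below with weights [1 - th]
   and [th]. *)
Variables k B th T : R.
Hypotheses (kE : 4 * mu * k = 1) (TE : 2 * t * T = 1) (BE : B = 4 * lF + 4 * lt)
  (th_gt0 : 0 < th)
  (th_eq : th * (16 * (k * B)) + 2 * (th * t) = t).

Let k_gt0 : 0 < k. Proof. by rewrite -(pmulr_rgt0 k (x := 4 * mu)) ?kE // mulr_gt0. Qed.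
Let T_gt0 : 0 < T.
Proof. by rewrite -(pmulr_rgt0 T (x := 2 * t)) ?TE // mulr_gt0. Qed.
Let kB_ge0 : 0 <= k * B.
Proof.
apply: mulr_ge0; first exact: ltW.
by rewrite BE; have := lF_ge0; have := lt_ge0; lra.
Qed.

(* [s] and [r] stand for the surrogate gradients at [xh] and at [x], [y] for
   the tracking variable. *)
Variables (x xh xs y s r : 'rV[R]_d).
Hypotheses (Kx : K x) (Kxh : K xh) (Kxs : K xs).
Hypotheses (s_lip : sqn (s - r) <= lt * sqn (xh - x))
  (s_mono : t * sqn (xh - x) <= dotp (s - r) (xh - x))
  (xh_opt : forall z, K z -> G xh <= dotp (s + y - r) (z - xh) + G z).

Let v := xh - x.
Let e := gF x - y.

(** Optimality tested at [x] and monotonicity of the surrogate gradient give the slope [- t * sqn v]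
    plus [dotp e v]. Young's inequality spends half of [t] against the error [e], the smallness of
    [a] a quarter against the curvature of [F]; a quarter remains. *)
Let descent (a : R) : 0 < a <= 1 -> (lF + 1) * a <= t / 4 ->
  F (x + a *: v) + G (x + a *: v) <=
  F x + G x - a * (t / 4) * sqn v + a * T * sqn e.
Proof.
move=> /andP[a0 a1] ha; have a01 : 0 <= a <= 1 by rewrite ltW.
have Kv : K (x + a *: v) by exact: segment_in.
have hG := Gcvx Kxh Kx a01.
have E : a *: xh + (1 - a) *: x = x + a *: v.
  by apply/rowP => j; rewrite !mxE; ring.
rewrite E in hG; have {}hG := hG Kv.
have := F_upper Kx Kv; rewrite (addrC x) addrK -(addrC x) dotpZr sqnZ => hF.
have := xh_opt Kx; rewrite -(opprB xh) dotpNr -/v => ho.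
have hs : dotp (s + y - r) v = dotp (s - r) v + dotp y v.
  by rewrite -dotpDl addrAC.
have he : dotp e v = dotp (gF x) v - dotp y v by rewrite dotpDl dotpNl.
have hy := dotp_young v e t_gt0.
rewrite dotpC in hy; have sm := s_mono; rewrite -/v in sm.
have E2 : t^-1 = 2 * T.
  by apply: (mulfI (lt0r_neq0 t_gt0)); rewrite divff ?gt_eqF //; have := TE; lra.
rewrite E2 in hy.
have main : dotp (gF x) v + (G xh - G x) <=
    - (t / 2) * sqn v + T * sqn e by lra.
have h2 : (lF + 1) * (a ^+ 2 * sqn v) <= a * (t / 4) * sqn v.
  rewrite expr2 -mulrA mulrCA -mulrA ler_pM2l // mulrA.
  by rewrite ler_wpM2r ?sqn_ge0.
rewrite -(ler_pM2l a0) in main.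
have -> : a * T * sqn e = a * (- (t / 2) * sqn v + T * sqn e)
   + a * (t / 2) * sqn v by ring.
have E3 : (1 - a) * G x = G x - a * G x by ring.
have E4 : a * (t / 2) * sqn v = a * (t / 4) * sqn v + a * (t / 4) * sqn v.
  by field.
lra.
Qed.

(** [F_lower] at [xh] and optimality tested at [xs] bound the gap. Their linear terms combine into
    [q], the true gradient at [xh] minus the one used by the agent, and Young's inequality absorbs
    [xs - xh] into the quadratic term of [F_lower]. *)
Let gap_bound : F xh + G xh - (F xs + G xs) <=
  k * (2 * sqn e + B * sqn v).
Proof.
have hF := F_lower Kxh Kxs; have hG := xh_opt Kxs.
pose p := gF xh - gF x; pose q := p + e - (s - r).
have qE : dotp q (xs - xh) = dotp (gF xh) (xs - xh) - dotp (s + y - r) (xs - xh).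
  by rewrite -dotpNl -dotpDl; congr dotp; apply/rowP => j; rewrite !mxE; ring.
have hq : sqn q <= 2 * sqn e + B * sqn v.
  have -> : q = e + (p - (s - r)) by rewrite /q [p + e]addrC -addrA.
  apply: le_trans (sqnD2_le _ _) _; have := sqnB2_le p (s - r).
  have := gF_lip Kxh Kx; rewrite -/p -/v; have := s_lip; rewrite -/v BE; lra.
have k2 : 0 < 2 * k by rewrite mulr_gt0.
have := dotp_young (- q) (xs - xh) k2.
rewrite sqnN dotpNl => hy; rewrite -(ler_pM2l k_gt0) in hq.
have k2E : (2 * k)^-1 = 2 * mu.
  apply: (mulfI (lt0r_neq0 k2)); rewrite divff ?gt_eqF //; have := kE; lra.
rewrite k2E in hy; lra.
Qed.

Lemma agent_progress (a : R) : 0 < a <= 1 -> (lF + 1) * a <= t / 4 ->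
  F (x + a *: v) + G (x + a *: v) - (F xs + G xs) <=
  (1 - th * a) * (F x + G x - (F xs + G xs)) - a * (t / 16) * sqn v
    + a * (T + 2 * k) * sqn e.
Proof.
move=> a01 ha; have hd := descent a01 ha; have hb := gap_bound.
case/andP: a01 => a0 a1; have a01 : 0 <= a <= 1 by rewrite ltW.
have Kv : K (x + a *: v) by exact: segment_in.
have E : a *: xh + (1 - a) *: x = x + a *: v.
  by apply/rowP => j; rewrite !mxE; ring.
have hF := Fcvx Kxh Kx a01; have hG := Gcvx Kxh Kx a01.
rewrite E in hF hG; have {}hF := hF Kv; have {}hG := hG Kv.
(* Convexity between [x] and [xh] carries the bound at [xh] over to the step of length [a]. *)
have hc : F (x + a *: v) + G (x + a *: v) - (F xs + G xs) <=
    (1 - a) * (F x + G x - (F xs + G xs))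
    + a * (k * (2 * sqn e + B * sqn v)).
  rewrite -(ler_pM2l a0) in hb; lra.
(* [th_eq] gives [th <= 1/2] and [th k B <= t / 16], so at least [t / 8 - t / 16] of the decrease in
   [sqn v] survives the combination. *)
have th1 : 2 * th <= 1.
  have := mulr_ge0 (ltW th_gt0) kB_ge0; have := th_eq => e1 e2.
  have : 2 * th * t <= 1 * t by lra.
  by rewrite ler_pM2r.
have hth : th * (k * B) <= t / 16.
  have := mulr_gt0 th_gt0 t_gt0; have := th_eq; lra.
set u := F x + G x in hd hc *; set P := F _ + G _ in hd hc *.
set us := F xs + G xs in hd hc *.
have {}hd : P - us <= u - us - a * (t / 4) * sqn v + a * T * sqn e.
  by lra.
have o0 : 0 <= 1 - th by have := th_gt0; lra.
have hd' := ler_wpM2l o0 hd; have hc' := ler_wpM2l (ltW th_gt0) hc.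
have e0 := sqn_ge0 e; have v0 := sqn_ge0 v.
have -> : P - us = (1 - th) * (P - us) + th * (P - us) by ring.
apply: le_trans (lerD hd' hc') _.
rewrite -subr_ge0.
have -> : (1 - th * a) * (u - us) - a * (t / 16) * sqn v
      + a * (T + 2 * k) * sqn e
   - ((1 - th) * (u - us - a * (t / 4) * sqn v + a * T * sqn e) +
      th * ((1 - a) * (u - us) + a * (k * (2 * sqn e + B * sqn v))))
  = a * sqn v * ((1 - th) * (t / 4) - th * (k * B) - t / 16)
    + a * sqn e * (th * T + 2 * ((1 - th) * k)) by field.
apply: addr_ge0; apply: mulr_ge0.
- by rewrite mulr_ge0 // ltW.
- have : 2 * th * t <= 1 * t by rewrite ler_pM2r.
  lra.
- by rewrite mulr_ge0 // ltW.
- apply: addr_ge0; first by rewrite mulr_ge0 // ltW.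
  by rewrite !mulr_ge0 // ltW.
Qed.

End AgentProgress.

(** * Linear rate of the coupled scalar recursions *)

(** The threshold depends on the constants only and the rate on [a] as well; only the factor [C]
    depends on the sequences. *)
Lemma coupled_linear_rate (R : realType) (c c' A rho B a0 : R) :
  0 < c -> 0 < c' -> 0 < A -> 0 < rho < 1 -> 0 < B -> 0 < a0 ->
  exists abar : R, 0 < abar <= 1 /\ abar <= a0 /\
  forall a, 0 < a < abar -> exists z : R, 0 < z < 1 /\
  forall p X Y D : nat -> R,
    (forall n, 0 <= X n) -> (forall n, 0 <= Y n) -> (forall n, 0 <= p n) ->
    (forall n, 0 <= D n) ->
    (forall n, p n.+1 <= (1 - c * a) * p n - a * c' * D n + a * A * (X n + Y n)) ->
    (forall n, X n.+1 <= rho * X n + a ^+ 2 * B * D n) ->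
    (forall n, Y n.+1 <= rho * Y n + B * X n + a ^+ 2 * B * D n) ->
    exists C, forall n, p n <= C * z ^+ n.
Proof.
move=> c_gt0 c'_gt0 A_gt0 /andP[r0 r1] B_gt0 a0_gt0.
(* The slack [1 - rho] is cut into four shares [q], to pay for the terms in [A], the term [B X] and
   the rate [c a]. *)
pose q := (1 - rho) / 4; have q0 : 0 < q by rewrite /q; lra.
have rhoE : rho = 1 - 4 * q by rewrite /q; field.
clearbody q.
(* [V = p + b X + Y] with [b] large enough to absorb the term [B X] *)
pose b := B / q; have b0 : 0 < b by rewrite divr_gt0.
have bq : b * q = B by rewrite /b divfK // gt_eqF.
(* [bA] makes [a A] at most one share in the rows of [Y] and [X], [bc] makes [c a] at most [q], and
   [bD] makes the coefficient of [D] nonpositive. *)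
pose bA := Num.min (q / A) (b * q / A); pose bc := q / c.
pose bD := c' / (b * B + B).
have bB0 : 0 < b * B + B by rewrite addr_gt0 // mulr_gt0.
exists (Num.min 1 (Num.min a0 (Num.min bA (Num.min bc bD)))).
split; last split.
- apply/andP; split; last by rewrite ge_min lexx.
  have hA1 : 0 < q / A by exact: divr_gt0.
  have hA2 : 0 < b * q / A by rewrite divr_gt0 // mulr_gt0.
  have hc0 : 0 < bc by exact: divr_gt0.
  have hD0 : 0 < bD by exact: divr_gt0.
  by rewrite !lt_min ltr01 a0_gt0 hA1 hA2 hc0 hD0.
- by rewrite !ge_min lexx !orbT.
move=> a; rewrite !lt_min => /andP[a_gt0 /and4P[a1 _ /andP[h1 h2] /andP[h3 h4]]].
rewrite ?/bc ?/bD !ltr_pdivlMr // in h1 h2 h3 h4.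
have c0 : 0 < c * a by rewrite mulr_gt0.
have q1 : q < 1 by lra.
exists (1 - c * a); split; first by apply/andP; split; lra.
move=> p X Y D X0 Y0 p0 D0 hp hX hY.
pose V n := p n + b * X n + Y n.
have V_dec n : V n.+1 <= (1 - c * a) * V n.
  have hbX := ler_wpM2l (ltW b0) (hX n).
  apply: (@le_trans _ _ ((1 - c * a) * p n + (a * A + b * rho + B) * X n
     + (a * A + rho) * Y n + a * (a * (b * B + B) - c') * D n)).
    rewrite /V; have := hp n; have := hY n; move: hbX; rewrite expr2; lra.
  have t1 : (a * A + b * rho + B) * X n <= (1 - c * a) * b * X n.
    rewrite ler_wpM2r //; have : c * a * b <= q * b.
      by rewrite ler_pM2r //; lra.
    have : b * rho = b - 4 * (b * q) by rewrite rhoE; ring.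
    lra.
  have t2 : (a * A + rho) * Y n <= (1 - c * a) * Y n.
    by rewrite ler_wpM2r //; lra.
  have t3 : a * (a * (b * B + B) - c') * D n <= 0.
    by rewrite mulr_le0_ge0 // mulr_ge0_le0 ?ltW //; lra.
  rewrite /V; lra.
exists (V 0%N) => n; apply: (@le_trans _ _ (V n)).
  by rewrite /V -addrA lerDl addr_ge0 // mulr_ge0 // ltW.
elim: n => [|n IH]; first by rewrite expr0 mulr1.
apply: le_trans (V_dec n) _; rewrite exprS mulrCA ler_wpM2l //; lra.
Qed.

(** * Gradient of a surrogate in its first argument *)

(** Difference quotients in the first argument are those of the joint function in the directions
    [row_mx v 0]. *)
Lemma has_grad_fst (R : realType) (d : nat) (ft : 'rV[R]_d -> 'rV[R]_d -> R)
    (O : set 'rV[R]_d) (x z : 'rV[R]_d) :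
  C2_on_pair ft O -> O x -> O z -> has_grad (fun z => ft z x) z.
Proof.
move=> [ft2 _] Ox Oz.
have /ft2[+ _] : [set p : 'rV[R]_(d + d) | O (lsubmx p) /\ O (rsubmx p)]
    (row_mx z x) by rewrite /= row_mxKl row_mxKr.
set Phi := (fun p => _); set p := row_mx z x => dPhi.
have E v : (fun h : R => h^-1 *: (((fun z => ft z x) \o shift z) (h *: v) - ft z x))
  = (fun h : R => h^-1 *: ((Phi \o shift p) (h *: row_mx v 0) - Phi p)).
  apply/funext => h /=; congr (_ *: (_ - _)).
    by rewrite /Phi /p scale_row_mx add_row_mx row_mxKl row_mxKr scaler0 add0r.
  by rewrite /Phi /p row_mxKl row_mxKr.
have dE v : derive (fun z => ft z x) z v = 'd Phi p (row_mx v 0).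
  by rewrite -deriveE // /derive E.
move=> v; split.
  by rewrite /derivable E; exact: diff_derivable.
have rE u : row_mx u 0 = u *m row_mx 1%:M 0 :> 'rV[R]_(d + d).
  by rewrite mul_mx_row mulmx1 mulmx0.
rewrite dE rE {1}(row_sum_delta v) mulmx_suml linear_sum.
by apply: eq_bigr => j _; rewrite -scalemxAl linearZ /= -rE mxE dE mulrC.
Qed.

(** * Gradient tracking error and gradient increments *)

Section Tracking.
Variables (R : realType) (d m : nat) (E : rel 'I_m) (W : 'M[R]_m).
Hypotheses (m_gt0 : (0 < m)%N) (hE : connected_undirected E)
  (hW : weight_matrix E W).
Variables (K : set 'rV[R]_d) (h : 'I_m -> 'rV[R]_d -> 'rV[R]_d) (l : R).
Hypotheses (l_ge0 : 0 <= l) (h_lip : forall i, sqlip l (h i) K).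
Implicit Types (x y v : 'I_m -> 'rV[R]_d).

Let mR_gt0 : 0 < m%:R :> R. Proof. by rewrite ltr0n. Qed.

Let w1 : \sum_(j < m) m%:R^-1 = 1 :> R.
Proof.
by rewrite sumr_const card_ord -(mulr_natl (m%:R^-1)) divff // gt_eqF.
Qed.

Let w0 (j : 'I_m) : 0 <= m%:R^-1 :> R. Proof. by rewrite invr_ge0 ltW. Qed.

Lemma avg_sqlip : sqlip l (fun z => m%:R^-1 *: \sum_i h i z) K.
Proof.
move=> z u Kz Ku; rewrite -scalerBr -sumrB scaler_sumr.
apply: le_trans (sqn_wmean_le _ w0 w1) _.
rewrite -mulr_sumr ler_pdivrMl //.
apply: (@le_trans _ _ (\sum_(i < m) l * sqn (z - u))).
  by apply: ler_sum => i _; exact: h_lip.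
by rewrite sumr_const card_ord mulr_natl.
Qed.

Lemma sum_pairs_le x :
  \sum_i \sum_j sqn (x i - x j) <= m%:R * (4 * ssq (dev x)).
Proof.
apply: (@le_trans _ _
  (\sum_i \sum_j (2 * sqn (dev x i) + 2 * sqn (dev x j)))).
  apply: ler_sum => i _; apply: ler_sum => j _.
  by have := sqnB2_le (dev x i) (dev x j); rewrite /dev opprB addrA subrK.
under eq_bigr do rewrite big_split /= sumr_const card_ord -mulr_sumr -/(ssq (dev x)).
rewrite big_split /= sumr_const card_ord sumrMnl -mulr_sumr -/(ssq (dev x)).
by rewrite -mulrnDl (mulr_natl _ m) lerMn2r; apply/orP; right; lra.
Qed.

(** Equal sums make the mean of [y] the average of the [h i (x i)]. The error is then [b j], which
    compares gradients at the points of different agents, minus [dev y j]. *)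
Lemma tracking_error x y : (forall i, K (x i)) ->
  \sum_i y i = \sum_i h i (x i) ->
  \sum_j sqn (m%:R^-1 *: (\sum_i h i (x j)) - y j)
    <= 8 * l * ssq (dev x) + 2 * ssq (dev y).
Proof.
move=> Kx sy; pose b j := m%:R^-1 *: \sum_i (h i (x j) - h i (x i)).
have bE j : m%:R^-1 *: (\sum_i h i (x j)) - y j = b j - dev y j.
  by rewrite /b sumrB scalerBr /dev /mean sy opprB addrA subrK.
have hb j : m%:R * sqn (b j) <= l * \sum_i sqn (x j - x i).
  rewrite -ler_pdivlMl // /b scaler_sumr.
  apply: le_trans (sqn_wmean_le _ w0 w1) _.
  rewrite -mulr_sumr ler_pM2l ?invr_gt0 // mulr_sumr.
  by apply: ler_sum => i _; exact: h_lip.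
have hB : \sum_j sqn (b j) <= 4 * l * ssq (dev x).
  rewrite -(ler_pM2l mR_gt0) mulr_sumr.
  apply: (@le_trans _ _ (\sum_j l * \sum_i sqn (x j - x i))).
    by apply: ler_sum => j _.
  rewrite -mulr_sumr; have := ler_wpM2l l_ge0 (sum_pairs_le x); lra.
apply: (@le_trans _ _ (\sum_j (2 * sqn (b j) + 2 * sqn (dev y j)))).
  by apply: ler_sum => j _; rewrite bE; exact: sqnB2_le.
rewrite big_split /= -!mulr_sumr -/(ssq (dev y)); lra.
Qed.

(** Mixing fixes constant families, so [x' - x] involves only [dev x] and the mixed step. *)
Lemma gradient_increment x v (a : R) (x' := mix W (fun i => x i + a *: v i)) :
  (forall i, K (x i)) -> (forall i, K (x' i)) ->
  ssq (fun i => h i (x' i) - h i (x i))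
    <= l * (8 * ssq (dev x) + 2 * a ^+ 2 * ssq v).
Proof.
move=> Kx Kx'.
apply: (@le_trans _ _ (l * ssq (fun i => x' i - x i))).
  by rewrite mulr_sumr; apply: ler_sum => i _; exact: h_lip.
apply: ler_wpM2l => //.
have -> : (fun i => x' i - x i) = (fun i => (mix W (dev x) i + (- 1) *: dev x i)
    + mix W (fun j => a *: v j) i).
  apply/funext => i; rewrite /x' mixD (mix_dev hW) scaleN1r /dev opprB.
  by rewrite [_ - mean x + _]addrA subrK addrAC.
apply: le_trans (ssqD2_le _ _) _.
have h1 := ssqD2_le (mix W (dev x)) (fun i => (-1) *: dev x i).
rewrite ssqZ sqrrN expr1n mul1r in h1.
have h2 := ssq_mix_le hW (dev x).
have := ssq_mix_le hW (fun j => a *: v j); rewrite ssqZ; lra.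
Qed.

End Tracking.

(** * Choice of constants and assembly of the three recursions *)

Theorem theorem3p9
  (R : realType) (d m : nat) (hm : (0 < m)%N)
  (* Problem (P), Assumption (A) *)
  (K O : set 'rV[R]_d) (f : 'I_m -> 'rV[R]_d -> R) (G : 'rV[R]_d -> R)
  (mu L : R)
  (hK0 : K !=set0) (hKc : closed K) (hKcvx : cvx_set K)
  (hO : open O) (hKO : K `<=` O)
  (hf2 : forall i, twice_diff_on_set (f i) O)
  (hfcvx : forall i, cvx_fun_on (f i) O)
  (hmu : 0 < mu)
  (hHF : forall x, K x -> forall v : 'rV[R]_d,
      mu * dotp v v <= qform (hess (fun z => m%:R^-1 * \sum_(i < m) f i z) x) v
                    <= L * dotp v v)
  (hGcvx : cvx_fun_on G K)
  (* the (unique) minimizer of U = F + G over K *)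
  (xstar : 'rV[R]_d) (hxsK : K xstar)
  (hxsmin : forall x, K x ->
      m%:R^-1 * (\sum_(i < m) f i xstar) + G xstar
        <= m%:R^-1 * (\sum_(i < m) f i x) + G x)
  (* Assumption (B) *)
  (E : rel 'I_m) (hE : connected_undirected E)
  (* Assumption (W) *)
  (W : 'M[R]_m) (hW : weight_matrix E W)
  (* Assumption (C): surrogates ft i (first argument x, second argument y) *)
  (ft : 'I_m -> 'rV[R]_d -> 'rV[R]_d -> R) (Lt mut Dl Du : 'I_m -> R)
  (hftC2 : forall i, C2_on_pair (ft i) O)
  (hftgrad : forall i x, K x -> grad (fun z => ft i z x) x = grad (f i) x)
  (hftlip : forall i x, K x -> lip_map_on (Lt i) (grad (fun z => ft i z x)) K)
  (hmut : forall i, 0 < mut i)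
  (hftsc : forall i x, K x -> strongly_cvx_on (mut i) (fun z => ft i z x) K)
  (hDlu : forall i, Dl i <= Du i)
  (hD : forall i x y, K x -> K y -> forall v : 'rV[R]_d,
      Dl i * dotp v v
        <= qform (hess (fun z => ft i z y) x
                  - hess (fun z => m%:R^-1 * \sum_(j < m) f j z) x) v
        <= Du i * dotp v v)
  (* the condition  mu~_min >= D^l_min *)
  (hmin : min_over Dl <= min_over mut) :
  exists abar : R, 0 < abar <= 1 /\
    forall alpha : R, 0 < alpha < abar ->
    (* any SONATA trajectory with step-size alpha *)
    forall (x y xhat : nat -> 'I_m -> 'rV[R]_d),
      (forall i, K (x 0%N i)) ->
      (forall i, y 0%N i = grad (f i) (x 0%N i)) ->
      (forall nu i, K (xhat nu i) /\
         forall z, K z ->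
           ft i (xhat nu i) (x nu i)
             + dotp (y nu i - grad (f i) (x nu i)) (xhat nu i - x nu i)
             + G (xhat nu i)
           <= ft i z (x nu i) + dotp (y nu i - grad (f i) (x nu i)) (z - x nu i)
              + G z) ->
      (forall nu i, x nu.+1 i =
         \sum_(j < m) W i j *: (x nu j + alpha *: (xhat nu j - x nu j))) ->
      (forall nu i, y nu.+1 i =
         \sum_(j < m) W i j *:
           (y nu j + grad (f j) (x nu.+1 j) - grad (f j) (x nu j))) ->
      forall i : 'I_m,
        exists (z C : R), 0 < z < 1 /\
          forall nu : nat,
            `| (m%:R^-1 * (\sum_(j < m) f j (x nu i)) + G (x nu i))
               - (m%:R^-1 * (\sum_(j < m) f j xstar) + G xstar) |
            <= C * z ^+ nu.
Proof.
pose F := favg f; pose h i := grad (f i).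
have mR : 0 < m%:R :> R by rewrite ltr0n.
have [W_ge0 [W_row W_col]] : (forall i j, 0 <= W i j) /\
    (forall i, \sum_j W i j = 1) /\ (forall j, \sum_i W i j = 1).
  by case: hW => _ [_].
have fK i : cvx_fun_on (f i) K.
  by move=> x y a Kx Ky a01 Ka; apply: hfcvx => //; exact: hKO.
have F_cvx : cvx_fun_on F K.
  move=> x y a Kx Ky a01 Ka; rewrite /F /favg.
  rewrite -(ler_pM2l mR) mulrA divff ?gt_eqF // mul1r.
  have -> : m%:R * (a * (m%:R^-1 * \sum_i f i x)
      + (1 - a) * (m%:R^-1 * \sum_i f i y))
    = \sum_i (a * f i x + (1 - a) * f i y).
    by rewrite big_split /= -!mulr_sumr; field; rewrite gt_eqF.
  by apply: ler_sum => i _; exact: fK.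
have U_cvx : cvx_fun_on (fun z => F z + G z) K.
  move=> x y a Kx Ky a01 Ka.
  by have := F_cvx x y a Kx Ky a01 Ka; have := hGcvx x y a Kx Ky a01 Ka; lra.
have F_grad z : K z -> has_grad F z by move=> /hKO; exact: has_grad_favg.
have gradF z : K z -> grad F z = m%:R^-1 *: \sum_i h i z.
  by move=> /hKO; exact: grad_favg.
have hess_ge0 i z v : K z -> 0 <= qform (hess (f i) z) v.
  move=> /hKO Oz; have := convex_bform_le v 0 hO (hf2 i) (hfcvx i) Oz.
  by rewrite bform0r addr0.
(* Each Hessian form is nonnegative, hence at most the sum of all of them, which is [m] times the
   form of the average. Using [|L| + 1] makes [M] positive. *)
pose M := m%:R * (`|L| + 1); have M_gt0 : 0 < M by rewrite mulr_gt0 // ltr_wpDl.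
have hess_le i z v : K z -> qform (hess (f i) z) v <= M * sqn v.
  move=> Kz; apply: (@le_trans _ _ (\sum_j qform (hess (f j) z) v)).
    by rewrite (bigD1 i) //= lerDl; apply: sumr_ge0 => j _; exact: hess_ge0.
  have /andP[_] := hHF z Kz v.
  rewrite [X in X <= _](qform_favg hO hf2) //; last exact: hKO.
  rewrite ler_pdivrMl // => /le_trans; apply; rewrite /M -mulrA ler_pM2l //.
  rewrite ler_wpM2r ?sqn_ge0 //; have := ler_norm L; lra.
pose l := 16 * M ^+ 2; have l_ge0 : 0 <= l by rewrite mulr_ge0 // sqr_ge0.
have h_lip i : sqlip l (h i) K.
  exact: (convex_grad_sqlip hO (hf2 i) (hfcvx i) hKO hKcvx M_gt0 (hess_le i)).
have gF_lip : sqlip l (grad F) K.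
  by move=> x y Kx Ky; rewrite !gradF //; exact: (avg_sqlip hm h_lip).
pose mu1 := mu / 4; have mu1_gt0 : 0 < mu1 by rewrite divr_gt0.
have F_lower x z : K x -> K z ->
    F x + dotp (grad F x) (z - x) + mu1 * sqn (z - x) <= F z.
  apply: (strong_convexity_of_hess F_grad _ hKcvx (ltW hmu)).
    by move=> y j /hKO; exact: has_grad_partial_favg.
  by move=> y v Ky; have /andP[] := hHF y Ky v.
have F_upper x z : K x -> K z ->
    F z <= F x + dotp (grad F x) (z - x) + (l + 1) * sqn (z - x).
  move=> Kx Kz; have := quadratic_bound hKcvx l_ge0 F_grad gF_lip Kx Kz.
  by rewrite ler_norml => /andP[_]; lra.
have [t t_gt0 ht] := finite_pos_lb hmut.
have [ls ls_gt0 hls] := finite_ub (fun i => Lt i ^+ 2).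
have ft_grad i x z : K x -> K z -> has_grad (fun z => ft i z x) z.
  by move=> /hKO Ox /hKO Oz; exact: has_grad_fst (hftC2 i) Ox Oz.
have ft_lip i x : K x -> sqlip (Lt i ^+ 2) (grad (fun z => ft i z x)) K.
  by move=> Kx; apply: lip_sqlip; exact: hftlip.
have [rho [Cc [rho01 Cc_gt0 hcons]]] := perturbed_consensus d hm hE hW.
pose k := (4 * mu1)^-1; have kE : 4 * mu1 * k = 1.
  by rewrite divff // gt_eqF // mulr_gt0.
pose T := (2 * t)^-1; have TE : 2 * t * T = 1.
  by rewrite divff // gt_eqF // mulr_gt0.
pose B := 4 * l + 4 * ls.
have k_gt0 : 0 < k by rewrite invr_gt0 mulr_gt0.
have T_gt0 : 0 < T by rewrite invr_gt0 mulr_gt0.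
have kB_ge0 : 0 <= k * B.
  by rewrite mulr_ge0 ?(ltW k_gt0) // addr_ge0 // mulr_ge0 // ltW.
have den_gt0 : 0 < 16 * (k * B) + 2 * t.
  by apply: ltr_wpDl; [exact: mulr_ge0 | exact: mulr_gt0].
(* The solution of [th_eq], which is linear in [th]. *)
pose th := t / (16 * (k * B) + 2 * t).
have th_gt0 : 0 < th by rewrite divr_gt0.
have th_eq : th * (16 * (k * B)) + 2 * (th * t) = t.
  have := divfK (lt0r_neq0 den_gt0) t; rewrite -/th mulrDr => {2}<-.
  by rewrite (mulrCA 2).
(* The coefficient of the tracking error in [agent_progress] times a common bound for [8 * l] and
   [2] from [tracking_error]. *)
pose A := (T + 2 * k) * (8 * l + 2).
have A_gt0 : 0 < A.
  by rewrite mulr_gt0 ?addr_gt0 ?mulr_gt0 // ltr_wpDl // mulr_ge0.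
(* Large enough for the perturbation of the [x] deviations, [Cc], and for that of the [y]
   deviations, [8 * Cc * l] and [2 * Cc * l]. *)
pose B2 := Cc * (1 + 8 * l).
have B2_gt0 : 0 < B2 by rewrite mulr_gt0 // ltr_pwDl // mulr_ge0.
pose a0 := t / (4 * (l + 1)).
have l1_gt0 : 0 < 4 * (l + 1) by rewrite mulr_gt0 // ltr_wpDl.
have a0_gt0 : 0 < a0 by rewrite divr_gt0.
have t16 : 0 < t / 16 by rewrite divr_gt0.
have [abar [abar01 [abar_a0 hrate]]] :=
  coupled_linear_rate th_gt0 t16 A_gt0 rho01 B2_gt0 a0_gt0.
exists abar; split=> // a a_abar x y xh Kx0 y0 hxh hx hy i.
have [z [z01 {}hrate]] := hrate a a_abar.
have a01 : 0 < a <= 1.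
  by case/andP: a_abar abar01 => -> /ltW aa /andP[_ /(le_trans aa)].
have a_small : (l + 1) * a <= t / 4.
  case/andP: a_abar => _ /ltW/le_trans/(_ abar_a0).
  rewrite /a0 ler_pdivlMr //; lra.
have a01' : 0 <= a <= 1 by case/andP: a01 => /ltW -> ->.
pose v n j := xh n j - x n j.
have xS n : x n.+1 = mix W (fun j => x n j + a *: v n j).
  by apply/funext => j; rewrite hx.
pose g n j := h j (x n.+1 j) - h j (x n j).
have yS n : y n.+1 = mix W (fun j => y n j + g n j).
  by apply/funext => j; rewrite hy; apply: eq_bigr => b _; rewrite addrA.
have Kstep n j : (forall b, K (x n b)) -> K (x n j + a *: v n j).
  by move=> Kn; apply: segment_in => //; case: (hxh n j).
(* Each new iterate is a convex combination of points of [K]. *)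
have Kx n : forall j, K (x n j).
  elim: n => // n IH j; rewrite xS.
  exact: (jensen hKcvx U_cvx (W_ge0 j) (W_row j) (fun b => Kstep n b IH)).1.
(* The tracking invariant: mixing preserves sums, and the gradient increments telescope. *)
have track n : \sum_j y n j = \sum_j h j (x n j).
  elim: n => [|n IH]; first by apply: eq_bigr => j _; rewrite y0.
  rewrite yS (sum_mix hW) big_split /= IH -big_split /=.
  by apply: eq_bigr => j _; rewrite addrCA subrr addr0.
pose us := F xstar + G xstar.
pose p n := \sum_j (F (x n j) + G (x n j) - us).
have u_ge0 n j : 0 <= F (x n j) + G (x n j) - us.
  by rewrite subr_ge0; exact: hxsmin.
have agent n j : F (x n j + a *: v n j) + G (x n j + a *: v n j) - us
    <= (1 - th * a) * (F (x n j) + G (x n j) - us) - a * (t / 16) * sqn (v n j)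
       + a * (T + 2 * k) * sqn (grad F (x n j) - y n j).
  have [Kxh xh_min] := hxh n j; have Kn := Kx n j.
  have g0 := sqr_ge0 (Lt j).
  pose s := grad (fun z => ft j z (x n j)).
  have sx : s (x n j) = h j (x n j) by exact: hftgrad.
  apply: (agent_progress hKcvx F_cvx hGcvx mu1_gt0 l_ge0 t_gt0 (ltW ls_gt0)
    F_lower F_upper gF_lip kE TE erefl th_gt0 th_eq (s := s (xh n j))
    (r := s (x n j)) Kn Kxh hxsK _ _ _ a01 a_small).
  - apply: le_trans (ft_lip _ _ Kn _ _ Kxh Kn) _.
    by rewrite ler_wpM2r ?sqn_ge0.
  - apply: (@le_trans _ _ (mut j * sqn (xh n j - x n j))).
      by rewrite ler_wpM2r ?sqn_ge0.
    exact: (strong_convexity_monotone hKcvx g0 (ltW (hmut j))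
      (fun z => @ft_grad j _ z Kn) (ft_lip j _ Kn) (hftsc j _ Kn) Kn Kxh).
  - move=> w Kw; rewrite sx.
    (* The linear correction is moved into the convex part, so that the variational inequality
       applies to the surrogate alone as smooth part. *)
    pose G' z := dotp (y n j - h j (x n j)) (z - x n j) + G z.
    have G'_cvx : cvx_fun_on G' K.
      move=> z1 z2 b K1 K2 b01 Kb; have := hGcvx z1 z2 b K1 K2 b01 Kb.
      rewrite /G'; have -> : b *: z1 + (1 - b) *: z2 - x n j
        = b *: (z1 - x n j) + (1 - b) *: (z2 - x n j).
        by apply/rowP => q; rewrite !mxE; ring.
      by rewrite dotpDr !dotpZr; lra.
    have min' u : K u ->
        ft j (xh n j) (x n j) + G' (xh n j) <= ft j u (x n j) + G' u.
      by move=> Ku; rewrite /G' !addrA; exact: xh_min.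
    have := minimizer_variational hKcvx g0 (fun z => @ft_grad j _ z Kn)
      (ft_lip j _ Kn) G'_cvx Kxh min' Kw.
    rewrite /G'.
    have -> : dotp (s (xh n j) + y n j - h j (x n j)) (w - xh n j)
      = dotp (s (xh n j)) (w - xh n j)
       + (dotp (y n j - h j (x n j)) (w - x n j)
          - dotp (y n j - h j (x n j)) (xh n j - x n j)).
      by rewrite -dotpNr -dotpDr opprB addrA subrK -dotpDl addrA.
    by rewrite -/s; lra.
(* Jensen's inequality on each row and unit column sums show that mixing does not increase the total
   gap; then sum the agents' progress. *)
have p_rec n : p n.+1 <= (1 - th * a) * p n - a * (t / 16) * ssq (v n)
    + a * A * (ssq (dev (x n)) + ssq (dev (y n))).
  apply: (@le_trans _ _
    (\sum_j (F (x n j + a *: v n j) + G (x n j + a *: v n j) - us))).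
    rewrite /p !sumrB lerD2r.
    apply: (@le_trans _ _ (\sum_j \sum_b W j b *
        (F (x n b + a *: v n b) + G (x n b + a *: v n b)))).
      apply: ler_sum => j _; rewrite xS.
      exact: (jensen hKcvx U_cvx (W_ge0 j) (W_row j)
        (fun b => Kstep n b (Kx n))).2.
    rewrite exchange_big /= le_eqVlt; apply/orP; left; apply/eqP.
    by apply: eq_bigr => b _; rewrite -mulr_suml W_col mul1r.
  apply: le_trans (ler_sum _ (fun j _ => agent n j)) _.
  rewrite big_split sumrB /= -!mulr_sumr -/(p n) -/(ssq (v n)) lerD2l.
  rewrite /A -!mulrA ler_pM2l; last by case/andP: a01.
  rewrite ler_pM2l ?addr_gt0 ?mulr_gt0 //.
  have := tracking_error hm l_ge0 h_lip (Kx n) (track n).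
  have -> : \sum_j sqn (m%:R^-1 *: (\sum_i h i (x n j)) - y n j)
     = \sum_j sqn (grad F (x n j) - y n j).
    by apply: eq_bigr => j _; rewrite gradF.
  move=> /le_trans; apply.
  have := mulr_ge0 l_ge0 (ssq_ge0 (dev (y n))).
  have := ssq_ge0 (dev (x n)); lra.
have D_ge0 n : 0 <= a ^+ 2 * ssq (v n) by rewrite mulr_ge0 ?sqr_ge0 // ssq_ge0.
have X_rec n : ssq (dev (x n.+1)) <=
    rho * ssq (dev (x n)) + a ^+ 2 * B2 * ssq (v n).
  rewrite xS; apply: le_trans (hcons _ _) _; rewrite lerD2l ssqZ.
  have := mulr_ge0 (mulr_ge0 (ltW Cc_gt0) l_ge0) (D_ge0 n); rewrite /B2; lra.
have Y_rec n : ssq (dev (y n.+1)) <= rho * ssq (dev (y n))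
    + B2 * ssq (dev (x n)) + a ^+ 2 * B2 * ssq (v n).
  rewrite yS; apply: le_trans (hcons _ _) _; rewrite -addrA lerD2l.
  have Kx' : forall j, K (mix W (fun b => x n b + a *: v n b) j).
    by move=> j; rewrite -xS.
  have := gradient_increment hW l_ge0 h_lip (Kx n) Kx'.
  rewrite -xS -/(g n) -(ler_pM2l Cc_gt0) => /le_trans; apply.
  have := mulr_ge0 (mulr_ge0 (ltW Cc_gt0) l_ge0) (D_ge0 n).
  have := mulr_ge0 (ltW Cc_gt0) (D_ge0 n).
  have := mulr_ge0 (ltW Cc_gt0) (ssq_ge0 (dev (x n))).
  by rewrite /B2; lra.
have p_ge0 n : 0 <= p n by apply: sumr_ge0 => j _; exact: u_ge0.
have [C hC] := hrate p (fun n => ssq (dev (x n))) (fun n => ssq (dev (y n)))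
  (fun n => ssq (v n)) (fun n => ssq_ge0 _) (fun n => ssq_ge0 _) p_ge0
  (fun n => ssq_ge0 _) p_rec X_rec Y_rec.
(* By minimality of [xstar] all gaps are nonnegative, so that of agent [i] is at most [p n]. *)
exists z, C; split=> // n; apply: le_trans (hC n).
rewrite -[X in `|X|]/(F (x n i) + G (x n i) - us) ger0_norm //.
by rewrite /p (bigD1 i) //= lerDl; apply: sumr_ge0.
Qed.
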